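(* Let $\mathcal{P}=He_1\oplus He_2$ be the free left $H$-module of rank two with basis $e_1,e_2$, equipped with an $H$-pseudoalgebra structure such that $e_{1}\ast e_{1}=0$ and $e_{2}\ast e_{2}=1\otimes1 \otimes_{H}e_{2}$ (and $e_1\ast e_2$, $e_2\ast e_1$ are arbitrary elements of $(H\otimes H)\otimes_H\mathcal{P}$). Then $\mathcal{P}$ is associative if and only if one of the following holds: (1) $e_{1}\ast e_{2}=e_{2}\ast e_{1}=0$; (2) $e_{1}\ast e_{2}=0$, $e_{2}\ast e_{1}=1\otimes1 \otimes_{H}e_{1}$; (3) $e_{1}\ast e_{2}=1\otimes1 \otimes_{H}e_{1}$, $e_{2}\ast e_{1}=0$; (4) $e_{1}\ast e_{2}=1\otimes1 \otimes_{H}e_{1}$, $e_{2}\ast e_{1}=1\otimes1 \otimes_{H}e_{1}$.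
   Context: $\mathbf{k}$ is an algebraically closed field of characteristic $0$, $\delta$ is a finite-dimensional Lie algebra over $\mathbf{k}$, and $H=U(\delta)$ is its universal enveloping algebra with the standard cocommutative Hopf structure ($\Delta(x)=x\otimes1+1\otimes x$ for $x\in\delta$). We regard $\mathbf{k},\delta\subset H$. $H^{\otimes n}$ is a right $H$-module via the iterated coproduct, e.g. $(f\otimes g)\cdot h=(f\otimes g)\Delta(h)$. An $H$-pseudoalgebra is a left $H$-module $A$ with a map $\ast:A\otimes A\to(H\otimes H)\otimes_H A$ that is $H$-bilinear: $hx\ast gy=(h\otimes g\otimes_H1)(x\ast y)$ for $x,y\in A$, $h,g\in H$. For $\beta\in H\otimes H$ and $x\ast y=\sum_i\alpha_i\otimes_Hc_i$ one sets, in $H^{\otimes3}\otimes_HA$, $(\beta\otimes_Hx)\ast y=\sum_i(\beta\otimes1)(\Delta\otimes\mathrm{id})(\alpha_i)\otimes_Hc_i$ and $x\ast(\beta\otimes_Hy)=\sum_i(1\otimes\beta)(\mathrm{id}\otimes\Delta)(\alpha_i)\otimes_Hc_i$. $A$ is associative if $(x\ast y)\ast z=x\ast(y\ast z)$ for all $x,y,z\in A$. Conventions: $f\otimes g\otimes_He$ means $(f\otimes g)\otimes_He$. By $H$-bilinearity a pseudoproduct on a free module is determined by its values on basis elements. *)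

(* Defs.v *)
From HB Require Import structures.
From mathcomp Require Import all_boot all_order all_algebra.
From mathcomp Require Import boolp classical_sets.

Set Implicit Arguments.
Unset Strict Implicit.
Unset Printing Implicit Defensive.

Import GRing.Theory.
Local Open Scope ring_scope.
Local Open Scope quotient_scope.

Reserved Notation "a \ot b" (at level 40, left associativity).
Reserved Notation "a \oH x" (at level 43, no associativity).

(* Balanced tensor product of a right module M and a left module N: the
   abelian group generated by the pairs (m, n), modulo biadditivity and
   (m r, n) = (m, r n). The two actions are explicit functions, since H (x) H
   carries several module structures at once. A formal sum of pairs is a list;
   no negative coefficients are needed, because - (m, n) = (- m, n). *)
Section Tensor.
Variables (R : Type) (M N : zmodType) (ra : M -> R -> M) (la : R -> N -> N).

Inductive tens_eq : seq (M * N) -> seq (M * N) -> Prop :=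
| TensRefl s : tens_eq s s
| TensSym s t : tens_eq s t -> tens_eq t s
| TensTrans s t u : tens_eq s t -> tens_eq t u -> tens_eq s u
| TensCat s s' t t' :
    tens_eq s s' -> tens_eq t t' -> tens_eq (s ++ t) (s' ++ t')
| TensComm s t : tens_eq (s ++ t) (t ++ s)
| Tens0 n : tens_eq [:: (0, n)] [::]
| TensDl m m' n : tens_eq [:: (m + m', n)] [:: (m, n); (m', n)]
| TensDr m n n' : tens_eq [:: (m, n + n')] [:: (m, n); (m, n')]
| TensBal m r n : tens_eq [:: (ra m r, n)] [:: (m, la r n)].

Definition tens_rel : rel (seq (M * N)) := fun s t => `[< tens_eq s t >].

Lemma tens_rel_refl : reflexive tens_rel.
Proof. by move=> s; apply/asboolP; apply: TensRefl. Qed.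
Lemma tens_rel_sym : symmetric tens_rel.
Proof. by move=> s t; apply/asboolP/asboolP => /TensSym. Qed.
Lemma tens_rel_trans : transitive tens_rel.
Proof.
by move=> t s u /asboolP st /asboolP tu; apply/asboolP; apply: TensTrans st tu.
Qed.

Canonical tens_equiv := EquivRel tens_rel tens_rel_refl tens_rel_sym
  tens_rel_trans.

Definition tens : Type := {eq_quot tens_rel}.
HB.instance Definition _ : EqQuotient _ tens_rel tens :=
  EqQuotient.on tens.
HB.instance Definition _ := Choice.on tens.

Lemma tens_piP s t : \pi_tens s = \pi_tens t <-> tens_eq s t.
Proof. by split=> [/eqmodP /asboolP|st] //; apply/eqmodP/asboolP. Qed.

Lemma tens_repr s : tens_eq (repr (\pi_tens s)) s.
Proof. by apply/tens_piP; rewrite reprK. Qed.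

Definition tens_add (u v : tens) : tens := \pi_tens (repr u ++ repr v).
Definition tens_opp (u : tens) : tens :=
  \pi_tens [seq (- p.1, p.2) | p <- repr u].

Lemma tens_add_pi s t : tens_add (\pi_tens s) (\pi_tens t) = \pi_tens (s ++ t).
Proof. by rewrite /tens_add; apply/tens_piP; apply: TensCat; apply: tens_repr. Qed.

Lemma tens_addA : associative tens_add.
Proof.
elim/quotW=> s; elim/quotW=> t; elim/quotW=> u.
by rewrite (tens_add_pi t u) (tens_add_pi s t) !tens_add_pi catA.
Qed.

Lemma tens_addC : commutative tens_add.
Proof. by move=> u v; rewrite /tens_add; apply/tens_piP/TensComm. Qed.

Lemma tens_add0 : left_id (\pi_tens [::]) tens_add.
Proof. by elim/quotW=> s; rewrite tens_add_pi. Qed.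

Lemma tens_eq_opp s : tens_eq ([seq (- p.1, p.2) | p <- s] ++ s) [::].
Proof.
elim: s => [|[m n] s IHs] /=; first exact: TensRefl.
apply: (TensTrans _ (TensCat (TensRefl [::]) IHs)).
set s' := map _ _; apply: (TensTrans (t := [:: (- m, n); (m, n)] ++ (s' ++ s))).
  rewrite -cat1s -[(_, _) :: _ in X in tens_eq _ X]cat1s -catA.
  apply: TensCat; first exact: TensRefl.
  rewrite -[(m, n) :: s]cat1s !catA; apply: TensCat; last exact: TensRefl.
  exact: TensComm.
apply: TensCat; last exact: TensRefl.
apply: TensTrans (Tens0 n); rewrite -[in X in tens_eq _ X](addNr m).
exact/TensSym/TensDl.
Qed.

Lemma tens_addN : left_inverse (\pi_tens [::]) tens_opp tens_add.
Proof.
move=> u; rewrite -[X in tens_add _ X]reprK /tens_opp tens_add_pi.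
by apply/tens_piP; apply: tens_eq_opp.
Qed.

HB.instance Definition _ :=
  GRing.isZmodule.Build tens tens_addA tens_addC tens_add0 tens_addN.

Definition tpure (m : M) (n : N) : tens := \pi_tens [:: (m, n)].

Record balanced (V : zmodType) (f : M -> N -> V) : Prop := Balanced {
  balDl : forall m m' n, f (m + m') n = f m n + f m' n;
  balDr : forall m n n', f m (n + n') = f m n + f m n';
  balA : forall m r n, f (ra m r) n = f m (la r n) }.

(* The additive map sending m (x) n to f m n; meaningful only if f is
   balanced (see tliftE). *)
Definition tlift (V : zmodType) (f : M -> N -> V) (t : tens) : V :=
  \sum_(p <- repr t) f p.1 p.2.

Lemma tens0E : 0 = \pi_tens [::] :> tens. Proof. by []. Qed.

Lemma tens_piD s t : \pi_tens (s ++ t) = \pi_tens s + \pi_tens t.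
Proof. by rewrite -tens_add_pi. Qed.

Lemma tpure_balanced : balanced tpure.
Proof.
split=> *; rewrite /tpure -?tens_piD; apply/tens_piP.
- exact: TensDl.
- exact: TensDr.
- exact: TensBal.
Qed.

Lemma tens_pi_sum s : \pi_tens s = \sum_(p <- s) tpure p.1 p.2.
Proof.
elim: s => [|[m n] s IHs]; first by rewrite big_nil.
by rewrite big_cons -IHs -tens_piD.
Qed.

Lemma tens_ind (P : tens -> Prop) :
    (forall m n, P (tpure m n)) -> P 0 -> (forall u v, P u -> P v -> P (u + v)) ->
  forall t, P t.
Proof.
move=> Ppure P0 PD; elim/quotW=> s; rewrite tens_pi_sum.
by elim/big_rec: _ => [|p u _ Pu] //; apply: PD.
Qed.

Section Lift.
Variables (V : zmodType) (f : M -> N -> V).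
Hypothesis balf : balanced f.

Lemma bal0l n : f 0 n = 0.
Proof. by apply: (addIr (f 0 n)); rewrite -(balDl balf) !add0r. Qed.

Lemma tlift_pi s : tlift f (\pi_tens s) = \sum_(p <- s) f p.1 p.2.
Proof.
rewrite /tlift; have := tens_repr s; move: (repr _) => s'; elim=> {s s'} //.
- by move=> s t u _ -> _ ->.
- by move=> s s' t t' _ IHs _ IHt; rewrite !big_cat IHs IHt.
- by move=> s t; rewrite !big_cat /= addrC.
- by move=> n; rewrite big_seq1 big_nil bal0l.
- by move=> m m' n; rewrite !big_cons big_nil !addr0 (balDl balf).
- by move=> m n n'; rewrite !big_cons big_nil !addr0 (balDr balf).
- by move=> m r n; rewrite !big_seq1 (balA balf).
Qed.

Lemma tliftE m n : tlift f (tpure m n) = f m n.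
Proof. by rewrite tlift_pi big_seq1. Qed.

Lemma tlift0 : tlift f 0 = 0.
Proof. by rewrite tens0E tlift_pi big_nil. Qed.

Lemma tliftD u v : tlift f (u + v) = tlift f u + tlift f v.
Proof.
elim/quotW: u => s; elim/quotW: v => t.
by rewrite -tens_piD !tlift_pi big_cat.
Qed.
End Lift.

Lemma tlift_sum s (V : zmodType) (f : M -> N -> V) : balanced f ->
  tlift f (\sum_(p <- s) tpure p.1 p.2) = \sum_(p <- s) f p.1 p.2.
Proof. by move=> balf; rewrite -tens_pi_sum tlift_pi. Qed.

Lemma tens_ext (V : zmodType) (F G : tens -> V) :
    {morph F : u v / u + v} -> {morph G : u v / u + v} ->
    (forall m n, F (tpure m n) = G (tpure m n)) ->
  F =1 G.
Proof.
move=> FD GD FG; elim/tens_ind => // [|u v IHu IHv]; last first.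
  by rewrite FD GD IHu IHv.
have H0 (K : tens -> V) : {morph K : u v / u + v} -> K 0 = 0.
  by move=> KD; apply: (addIr (K 0)); rewrite -KD !add0r.
by rewrite !H0.
Qed.

End Tensor.

(* Needed only for 1 (x) 1 != 0. *)
Lemma exists_functional (k : fieldType) (V : lmodType k) (v : V) : v != 0 ->
  exists f : V -> k, [/\ forall x y, f (x + y) = f x + f y,
    forall c x, f (c *: x) = c * f x & f v = 1].
Proof.
move=> v0.
pose P (W : set V) := [/\ forall x y, W x -> W y -> W (x + y),
  forall c x, W x -> W (c *: x) & ~ W v].
have [|W [[WD WZ Wv] Wmax]] := @Zorn_bigcup V P.
  move=> F FP Ftot; split.
  - move=> x y [A FA Ax] [B FB By].
    have [AB|BA] := Ftot _ _ FA FB.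
      by exists B => //; have [+ _ _] := FP _ FB; apply=> //; apply: AB.
    by exists A => //; have [+ _ _] := FP _ FA; apply=> //; apply: BA.
  - by move=> c x [A FA Ax]; exists A => //; have [_ + _] := FP _ FA; apply.
  - by move=> [A FA Av]; have [_ _] := FP _ FA; apply.
have W0 : W 0.
  apply: contrapT => nW0.
  apply: (Wmax (W `|` [set 0])%classic).
    split; first by move=> x Wx; left.
    by move=> /(_ 0) H; apply: nW0; apply: H; right.
  split.
  - move=> x y [Wx|->] [Wy|->]; rewrite ?addr0 ?add0r.
    + by left; apply: WD.
    + by left.
    + by left.
    + by right.
  - by move=> c x [Wx|->]; [left; apply: WZ|right; rewrite scaler0].
  - by case=> // /eqP; apply/negP.
have WN x : W x -> W (- x) by rewrite -scaleN1r; apply: WZ.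
have dec x : exists c, W (x - c *: v).
  have [Wx|nWx] := pselect (W x); first by exists 0; rewrite scale0r subr0.
  pose B : set V := fun y => exists w a, W w /\ y = w + a *: x.
  have nPB : ~ P B.
    apply: Wmax; split; first by move=> w Ww; exists w, 0; rewrite scale0r addr0.
    by move=> BW; apply: nWx; apply: BW; exists 0, 1; rewrite scale1r add0r.
  have [w [a [Ww vE]]] : B v.
    apply: contrapT => nBv; apply: nPB; split=> //.
    - move=> _ _ [w [a [Ww ->]]] [w' [a' [Ww' ->]]].
      exists (w + w'), (a + a'); split; first exact: WD.
      by rewrite scalerDl addrACA.
    - move=> c _ [w [a [Ww ->]]]; exists (c *: w), (c * a).
      by split; [exact: WZ|rewrite scalerDr scalerA].
  have a0 : a != 0.
    by apply: contra_notN Wv => /eqP a0; rewrite vE a0 scale0r addr0.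
  exists a^-1; suff -> : x - a^-1 *: v = - (a^-1 *: w) by apply/WN/WZ.
  by rewrite vE scalerDr scalerA mulVf // scale1r addrC opprD subrK.
have uniq x c c' : W (x - c *: v) -> W (x - c' *: v) -> c = c'.
  move=> Wc Wc'; apply/eqP; rewrite eq_sym -subr_eq0; apply: contra_notT Wv => cc.
  have := WD _ _ (WN _ Wc') Wc.
  have -> : - (x - c' *: v) + (x - c *: v) = (c' - c) *: v.
    by rewrite opprB addrA subrK scalerBl.
  by move=> /(WZ (c' - c)^-1); rewrite scalerA mulVf // scale1r.
have [f fP] := choice dec.
exists f; split.
- move=> x y; apply: (uniq (x + y)) => //.
  by rewrite scalerDl opprD addrACA; apply: WD.
- by move=> c x; apply: (uniq (c *: x)) => //; rewrite -scalerA -scalerBr; apply: WZ.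
- by apply: (uniq v) => //; rewrite scale1r subrr.
Qed.

Section TensorAlgebra.
Variables (k : fieldType) (A B : algType k).

Definition algtens : Type :=
  tens (fun (a : A) (c : k) => c *: a) (fun (c : k) (b : B) => c *: b).
HB.instance Definition _ := GRing.Zmodule.on algtens.

Definition atpure (a : A) (b : B) : algtens := tpure _ _ a b.
Local Notation "a \ot b" := (atpure a b) : ring_scope.

Lemma otDl a a' b : (a + a') \ot b = a \ot b + a' \ot b.
Proof. exact: balDl (tpure_balanced _ _) _ _ _. Qed.
Lemma otDr a b b' : a \ot (b + b') = a \ot b + a \ot b'.
Proof. exact: balDr (tpure_balanced _ _) _ _ _. Qed.
Lemma otA a (c : k) b : (c *: a) \ot b = a \ot (c *: b).
Proof. exact: balA (tpure_balanced _ _) _ _ _. Qed.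

Definition atlift (V : zmodType) (f : A -> B -> V) (t : algtens) : V :=
  tlift f t.

Definition atbalanced (V : zmodType) (f : A -> B -> V) : Prop :=
  balanced (fun (a : A) (c : k) => c *: a) (fun (c : k) (b : B) => c *: b) f.

Lemma atliftE (V : zmodType) (f : A -> B -> V) a b :
  atbalanced f -> atlift f (a \ot b) = f a b.
Proof. by move=> balf; apply: tliftE. Qed.

Lemma atliftD (V : zmodType) (f : A -> B -> V) :
  atbalanced f -> {morph atlift f : u v / u + v}.
Proof. by move=> balf u v; apply: tliftD. Qed.

Lemma at_ext (V : zmodType) (F G : algtens -> V) :
    {morph F : u v / u + v} -> {morph G : u v / u + v} ->
    (forall a b, F (a \ot b) = G (a \ot b)) ->
  F =1 G.
Proof. exact: tens_ext. Qed.

Lemma atlift_ext (V : zmodType) (f g : A -> B -> V) :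
  f =2 g -> atlift f =1 atlift g.
Proof. by move=> fg t; apply: eq_bigr => p _; apply: fg. Qed.

Definition at_scale (c : k) : algtens -> algtens :=
  atlift (fun a b => (c *: a) \ot b).

Lemma at_scale_bal c : atbalanced (fun a b => (c *: a) \ot b).
Proof.
split=> [a a' b|a b b'|a e b].
- by rewrite scalerDr otDl.
- by rewrite otDr.
- by rewrite scalerA mulrC -scalerA otA.
Qed.

Lemma at_scaleE c a b : at_scale c (a \ot b) = (c *: a) \ot b.
Proof. exact: (atliftE _ _ (at_scale_bal c)). Qed.

Lemma at_scaleD c : {morph at_scale c : u v / u + v}.
Proof. exact: (atliftD (at_scale_bal c)). Qed.

Lemma at_scalerA a b u : at_scale a (at_scale b u) = at_scale (a * b) u.
Proof.
move: u; apply: at_ext => [u v|u v|x y]; rewrite ?at_scaleD //.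
by rewrite !at_scaleE scalerA.
Qed.

Lemma at_scale1r : left_id 1 at_scale.
Proof.
by move=> u; move: u; apply: at_ext => [u v|u v|x y];
  rewrite ?at_scaleD // at_scaleE scale1r.
Qed.

Lemma at_scalerDl u : {morph at_scale^~ u : a b / a + b}.
Proof.
move=> a b /=; move: u; apply: at_ext => [u v|u v|x y].
- exact: at_scaleD.
- by rewrite !at_scaleD addrACA.
- by rewrite !at_scaleE scalerDl otDl.
Qed.

HB.instance Definition _ := GRing.Zmodule_isLmodule.Build k algtens
  at_scalerA at_scale1r at_scaleD at_scalerDl.

Lemma otZl c a b : c *: (a \ot b) = (c *: a) \ot b.
Proof. exact: at_scaleE. Qed.
Lemma otZr c a b : c *: (a \ot b) = a \ot (c *: b).
Proof. by rewrite otZl otA. Qed.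

Definition at_mulp (a : A) (b : B) : algtens -> algtens :=
  atlift (fun a' b' => (a * a') \ot (b * b')).

Lemma at_mulp_bal a b : atbalanced (fun a' b' => (a * a') \ot (b * b')).
Proof.
split=> *; rewrite ?mulrDr ?otDl ?otDr //.
by rewrite -!scalerAr otA.
Qed.

Lemma at_mulpE a b a' b' : at_mulp a b (a' \ot b') = (a * a') \ot (b * b').
Proof. exact: (atliftE _ _ (at_mulp_bal a b)). Qed.

Lemma at_mulpD a b : {morph at_mulp a b : u v / u + v}.
Proof. exact: (atliftD (at_mulp_bal a b)). Qed.

Definition at_mul (u v : algtens) : algtens :=
  atlift (fun a b => at_mulp a b v) u.

Lemma at_mul_bal v : atbalanced (fun a b => at_mulp a b v).
Proof.
split=> [a a' b|a b b'|a c b]; move: v; apply: at_ext => [u v|u v|x y].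
- exact: at_mulpD.
- by rewrite !at_mulpD addrACA.
- by rewrite !at_mulpE mulrDl otDl.
- exact: at_mulpD.
- by rewrite !at_mulpD addrACA.
- by rewrite !at_mulpE mulrDl otDr.
- exact: at_mulpD.
- exact: at_mulpD.
- by rewrite !at_mulpE -!scalerAl otA.
Qed.

Lemma at_mul_pure a b v : at_mul (a \ot b) v = at_mulp a b v.
Proof. exact: (atliftE _ _ (at_mul_bal v)). Qed.

Lemma at_mulE a b a' b' :
  at_mul (a \ot b) (a' \ot b') = (a * a') \ot (b * b').
Proof. by rewrite at_mul_pure at_mulpE. Qed.

Lemma at_mulDl : left_distributive at_mul +%R.
Proof. by move=> u v w; apply: (atliftD (at_mul_bal w)). Qed.

Lemma at_mulDr : right_distributive at_mul +%R.
Proof.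
move=> u v w; move: u; apply: at_ext => [u u'|u u'|x y].
- exact: at_mulDl.
- by rewrite !at_mulDl addrACA.
- by rewrite !at_mul_pure at_mulpD.
Qed.

Lemma at_mulA : associative at_mul.
Proof.
move=> u v w; move: u; apply: at_ext => [u u'|u u'|a b]; rewrite ?at_mulDl //.
move: v; apply: at_ext => [v v'|v v'|a' b'];
  rewrite ?(at_mulDl, at_mulDr) //.
move: w; apply: at_ext => [w w'|w w'|a'' b'']; rewrite ?at_mulDr //.
by rewrite !at_mulE !mulrA.
Qed.

Lemma at_mul1l : left_id (1 \ot 1) at_mul.
Proof.
by move=> u; move: u; apply: at_ext => [u v|u v|a b];
  rewrite ?at_mulDr // at_mulE !mul1r.
Qed.

Lemma at_mul1r : right_id (1 \ot 1) at_mul.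
Proof.
by move=> u; move: u; apply: at_ext => [u v|u v|a b];
  rewrite ?at_mulDl // at_mulE !mulr1.
Qed.

Lemma at_neq0 : 1 \ot 1 != 0.
Proof.
have [f [fD fZ f1]] := exists_functional (oner_neq0 A).
have [g [gD gZ g1]] := exists_functional (oner_neq0 B).
have bal : atbalanced (fun a b => f a * g b).
  split=> [a a' b|a b b'|a c b]; rewrite ?fD ?gD ?mulrDl ?mulrDr //.
  by rewrite fZ gZ mulrA (mulrC c).
apply/eqP => /(congr1 (atlift (fun a b => f a * g b))).
rewrite (atliftE _ _ bal) f1 g1 mulr1 /atlift (tlift0 bal).
by apply/eqP; apply: oner_neq0.
Qed.

HB.instance Definition _ := GRing.Zmodule_isNzRing.Build algtens
  at_mulA at_mul1l at_mul1r at_mulDl at_mulDr at_neq0.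

Lemma otM a b a' b' : (a \ot b) * (a' \ot b') = (a * a') \ot (b * b').
Proof. exact: at_mulE. Qed.

Lemma ot1 : 1 \ot 1 = 1. Proof. by []. Qed.

Lemma at_scalerAl (c : k) (u v : algtens) : c *: (u * v) = (c *: u) * v.
Proof.
move: u; apply: at_ext => [u u'|u u'|a b]; rewrite ?(mulrDl, scalerDr) //.
move: v; apply: at_ext => [v v'|v v'|a' b']; rewrite ?(mulrDr, scalerDr) //.
by rewrite otM !otZl otM scalerAl.
Qed.

HB.instance Definition _ := GRing.Lmodule_isLalgebra.Build k algtens
  at_scalerAl.

Lemma at_scalerAr (c : k) (u v : algtens) : c *: (u * v) = u * (c *: v).
Proof.
move: u; apply: at_ext => [u u'|u u'|a b]; rewrite ?(mulrDl, scalerDr) //.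
move: v; apply: at_ext => [v v'|v v'|a' b']; rewrite ?(mulrDr, scalerDr) //.
by rewrite otM !otZl otM scalerAr.
Qed.

HB.instance Definition _ := GRing.Lalgebra_isAlgebra.Build k algtens
  at_scalerAr.

End TensorAlgebra.

Notation "a \ot b" := (atpure a b) : ring_scope.

HB.mixin Record Vector_isLieAlgebra (k : fieldType) L of Vector k L := {
  lie : L -> L -> L;
  lie_linear_l : forall z : L, linear (lie^~ z);
  lie_linear_r : forall x : L, linear (lie x);
  lie_alt : forall x : L, lie x x = 0;
  lie_jacobi : forall x y z : L,
    lie x (lie y z) + lie y (lie z x) + lie z (lie x y) = 0
}.

(* Finite dimension is part of the vectType structure. *)
#[short(type="lieAlgType")]
HB.structure Definition LieAlgebra (k : fieldType) :=
  { L of Vector k L & Vector_isLieAlgebra k L }.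

(* U(d), presented as the unital associative k-algebra with generators
   the elements of d, subject to linearity and [x, y] = x y - y x. *)
Section Enveloping.
Variables (k : fieldType) (d : lieAlgType k).

Inductive uterm : Type :=
| UGen (x : d)
| UScal (c : k)
| UAdd (s t : uterm)
| UMul (s t : uterm).

Inductive uea_eq : uterm -> uterm -> Prop :=
| UeaRefl s : uea_eq s s
| UeaSym s t : uea_eq s t -> uea_eq t s
| UeaTrans s t u : uea_eq s t -> uea_eq t u -> uea_eq s u
| UeaAdd s s' t t' :
    uea_eq s s' -> uea_eq t t' -> uea_eq (UAdd s t) (UAdd s' t')
| UeaMul s s' t t' :
    uea_eq s s' -> uea_eq t t' -> uea_eq (UMul s t) (UMul s' t')
| UeaAddA s t u : uea_eq (UAdd s (UAdd t u)) (UAdd (UAdd s t) u)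
| UeaAddC s t : uea_eq (UAdd s t) (UAdd t s)
| UeaAdd0 s : uea_eq (UAdd (UScal 0) s) s
| UeaAddN s : uea_eq (UAdd (UMul (UScal (-1)) s) s) (UScal 0)
| UeaMulA s t u : uea_eq (UMul s (UMul t u)) (UMul (UMul s t) u)
| UeaMul1l s : uea_eq (UMul (UScal 1) s) s
| UeaMul1r s : uea_eq (UMul s (UScal 1)) s
| UeaMulDl s t u : uea_eq (UMul (UAdd s t) u) (UAdd (UMul s u) (UMul t u))
| UeaMulDr s t u : uea_eq (UMul s (UAdd t u)) (UAdd (UMul s t) (UMul s u))
| UeaScalD a b : uea_eq (UScal (a + b)) (UAdd (UScal a) (UScal b))
| UeaScalM a b : uea_eq (UScal (a * b)) (UMul (UScal a) (UScal b))
| UeaScalC a s : uea_eq (UMul (UScal a) s) (UMul s (UScal a))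
| UeaGenD x y : uea_eq (UGen (x + y)) (UAdd (UGen x) (UGen y))
| UeaGenZ a x : uea_eq (UGen (a *: x)) (UMul (UScal a) (UGen x))
| UeaLie x y : uea_eq (UGen (lie x y))
    (UAdd (UMul (UGen x) (UGen y))
          (UMul (UScal (-1)) (UMul (UGen y) (UGen x)))).

HB.instance Definition _ := gen_eqMixin uterm.
HB.instance Definition _ := gen_choiceMixin uterm.

Definition uea_rel : rel uterm := fun s t => `[< uea_eq s t >].

Lemma uea_rel_refl : reflexive uea_rel.
Proof. by move=> s; apply/asboolP; apply: UeaRefl. Qed.
Lemma uea_rel_sym : symmetric uea_rel.
Proof. by move=> s t; apply/asboolP/asboolP => /UeaSym. Qed.
Lemma uea_rel_trans : transitive uea_rel.
Proof.
by move=> t s u /asboolP st /asboolP tu; apply/asboolP; apply: UeaTrans st tu.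
Qed.

Canonical uea_equiv := EquivRel uea_rel uea_rel_refl uea_rel_sym uea_rel_trans.

Definition uea : Type := {eq_quot uea_rel}.
HB.instance Definition _ : EqQuotient _ uea_rel uea := EqQuotient.on uea.
HB.instance Definition _ := Choice.on uea.

Lemma uea_piP s t : \pi_uea s = \pi_uea t <-> uea_eq s t.
Proof. by split=> [/eqmodP /asboolP|st] //; apply/eqmodP/asboolP. Qed.

Lemma uea_repr s : uea_eq (repr (\pi_uea s)) s.
Proof. by apply/uea_piP; rewrite reprK. Qed.

Definition uea_add (u v : uea) : uea := \pi_uea (UAdd (repr u) (repr v)).
Definition uea_mul (u v : uea) : uea := \pi_uea (UMul (repr u) (repr v)).
Definition uea_scal (c : k) : uea := \pi_uea (UScal c).
Definition uea_opp (u : uea) : uea := uea_mul (uea_scal (-1)) u.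

Lemma uea_add_pi s t : uea_add (\pi_uea s) (\pi_uea t) = \pi_uea (UAdd s t).
Proof. by rewrite /uea_add; apply/uea_piP/UeaAdd; apply: uea_repr. Qed.

Lemma uea_mul_pi s t : uea_mul (\pi_uea s) (\pi_uea t) = \pi_uea (UMul s t).
Proof. by rewrite /uea_mul; apply/uea_piP/UeaMul; apply: uea_repr. Qed.

Lemma uea_addA : associative uea_add.
Proof.
elim/quotW=> s; elim/quotW=> t; elim/quotW=> u.
rewrite (uea_add_pi t u) (uea_add_pi s t) (uea_add_pi s) uea_add_pi.
exact/uea_piP/UeaAddA.
Qed.

Lemma uea_addC : commutative uea_add.
Proof.
elim/quotW=> s; elim/quotW=> t; rewrite (uea_add_pi s t) (uea_add_pi t s).
exact/uea_piP/UeaAddC.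
Qed.

Lemma uea_add0 : left_id (uea_scal 0) uea_add.
Proof. by elim/quotW=> s; rewrite uea_add_pi; apply/uea_piP/UeaAdd0. Qed.

Lemma uea_addN : left_inverse (uea_scal 0) uea_opp uea_add.
Proof.
elim/quotW=> s; rewrite /uea_opp (uea_mul_pi (UScal (-1)) s) uea_add_pi.
exact/uea_piP/UeaAddN.
Qed.

HB.instance Definition _ :=
  GRing.isZmodule.Build uea uea_addA uea_addC uea_add0 uea_addN.

Lemma uea_mulA : associative uea_mul.
Proof.
elim/quotW=> s; elim/quotW=> t; elim/quotW=> u.
rewrite (uea_mul_pi t u) (uea_mul_pi s t) (uea_mul_pi s) uea_mul_pi.
exact/uea_piP/UeaMulA.
Qed.

Lemma uea_mul1l : left_id (uea_scal 1) uea_mul.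
Proof. by elim/quotW=> s; rewrite uea_mul_pi; apply/uea_piP/UeaMul1l. Qed.

Lemma uea_mul1r : right_id (uea_scal 1) uea_mul.
Proof. by elim/quotW=> s; rewrite uea_mul_pi; apply/uea_piP/UeaMul1r. Qed.

Lemma uea_mulDl : left_distributive uea_mul uea_add.
Proof.
elim/quotW=> s; elim/quotW=> t; elim/quotW=> u.
rewrite (uea_add_pi s t) (uea_mul_pi s u) (uea_mul_pi t u) uea_mul_pi uea_add_pi.
exact/uea_piP/UeaMulDl.
Qed.

Lemma uea_mulDr : right_distributive uea_mul uea_add.
Proof.
elim/quotW=> s; elim/quotW=> t; elim/quotW=> u.
rewrite (uea_add_pi t u) (uea_mul_pi s t) (uea_mul_pi s u) uea_mul_pi uea_add_pi.
exact/uea_piP/UeaMulDr.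
Qed.

(* The interpretation of terms in an algebra B, given values of the
   generators. *)
Fixpoint ueval (B : algType k) (phi : d -> B) (t : uterm) : B :=
  match t with
  | UGen x => phi x
  | UScal c => c%:A
  | UAdd s t => ueval phi s + ueval phi t
  | UMul s t => ueval phi s * ueval phi t
  end.

Definition lie_morph (B : algType k) (phi : d -> B) : Prop :=
  linear phi /\ forall x y, phi (lie x y) = phi x * phi y - phi y * phi x.

Lemma ueval_eq (B : algType k) (phi : d -> B) s t :
  lie_morph phi -> uea_eq s t -> ueval phi s = ueval phi t.
Proof.
move=> [phil phib]; elim=> {s t} //=.
- by move=> s t u _ -> _ ->.
- by move=> s s' t t' _ -> _ ->.
- by move=> s s' t t' _ -> _ ->.
- by move=> s t u; rewrite addrA.
- by move=> s t; rewrite addrC.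
- by move=> s; rewrite scale0r add0r.
- by move=> s; rewrite scaleN1r mulN1r addNr scale0r.
- by move=> s t u; rewrite mulrA.
- by move=> s; rewrite scale1r mul1r.
- by move=> s; rewrite scale1r mulr1.
- by move=> s t u; rewrite mulrDl.
- by move=> s t u; rewrite mulrDr.
- by move=> a b; rewrite scalerDl.
- by move=> a b; rewrite -scalerAl mul1r scalerA.
- by move=> a s; rewrite -scalerAl -scalerAr mul1r mulr1.
- by move=> x y; have := phil 1 x y; rewrite !scale1r.
- move=> a x; rewrite mulr_algl; have := phil a x 0.
  by have := phil (-1) 0 0; rewrite !addr0 !scaleN1r oppr0 addNr => ->; rewrite addr0.
- by move=> x y; rewrite phib scaleN1r mulN1r.
Qed.

Lemma uea_neq0 : uea_scal 1 != uea_scal 0.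
Proof.
apply/eqP => /uea_piP /(@ueval_eq k^o (fun=> 0)) /= H.
have : 1%:A = 0%:A :> k^o.
  apply: H; split=> [a x y|x y]; first by rewrite scaler0 addr0.
  by rewrite mulr0 subr0.
by rewrite scale1r scale0r; apply/eqP; apply: oner_neq0.
Qed.

HB.instance Definition _ := GRing.Zmodule_isNzRing.Build uea
  uea_mulA uea_mul1l uea_mul1r uea_mulDl uea_mulDr uea_neq0.

Lemma uea_piD s t : \pi_uea (UAdd s t) = \pi_uea s + \pi_uea t.
Proof. by rewrite -uea_add_pi. Qed.
Lemma uea_piM s t : \pi_uea (UMul s t) = \pi_uea s * \pi_uea t.
Proof. by rewrite -uea_mul_pi. Qed.

Lemma uea_scalD a b : uea_scal (a + b) = uea_scal a + uea_scal b.
Proof.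
by rewrite /uea_scal -uea_piD; apply/uea_piP/UeaScalD.
Qed.

Lemma uea_scalM a b : uea_scal (a * b) = uea_scal a * uea_scal b.
Proof. by rewrite /uea_scal -uea_piM; apply/uea_piP/UeaScalM. Qed.

Lemma uea_scalC a u : uea_scal a * u = u * uea_scal a.
Proof.
elim/quotW: u => s.
by rewrite /uea_scal -!uea_piM; apply/uea_piP/UeaScalC.
Qed.

Definition uea_scale (a : k) (u : uea) : uea := uea_scal a * u.

Lemma uea_scalerA a b u : uea_scale a (uea_scale b u) = uea_scale (a * b) u.
Proof. by rewrite /uea_scale uea_scalM mulrA. Qed.
Lemma uea_scale1r : left_id 1 uea_scale.
Proof. by move=> u; apply: mul1r. Qed.
Lemma uea_scalerDr : right_distributive uea_scale +%R.
Proof. by move=> a u v; apply: mulrDr. Qed.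
Lemma uea_scalerDl u : {morph uea_scale^~ u : a b / a + b}.
Proof. by move=> a b; rewrite /uea_scale uea_scalD mulrDl. Qed.

HB.instance Definition _ := GRing.Zmodule_isLmodule.Build k uea
  uea_scalerA uea_scale1r uea_scalerDr uea_scalerDl.

Lemma uea_scalerAl (a : k) (u v : uea) : a *: (u * v) = (a *: u) * v.
Proof. exact: mulrA. Qed.

HB.instance Definition _ := GRing.Lmodule_isLalgebra.Build k uea uea_scalerAl.

Lemma uea_scalerAr (a : k) (u v : uea) : a *: (u * v) = u * (a *: v).
Proof.
by rewrite -[LHS]/(uea_scal a * (u * v)) -[a *: v]/(uea_scal a * v)
  mulrA uea_scalC -mulrA.
Qed.

HB.instance Definition _ := GRing.Lalgebra_isAlgebra.Build k uea uea_scalerAr.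

Lemma uea_piS c : \pi_uea (UScal c) = c%:A.
Proof. by rewrite -[RHS]/(uea_scal c * 1) mulr1. Qed.

Definition uea_in (x : d) : uea := \pi_uea (UGen x).

Lemma uea_in_morph : lie_morph (uea_in : d -> uea).
Proof.
split=> [a x y|x y].
  rewrite -[a *: uea_in x]mulr_algl -uea_piS -uea_piM -uea_piD.
  apply/uea_piP; apply: (UeaTrans (UeaGenD _ _)).
  by apply: UeaAdd; [apply: UeaGenZ | apply: UeaRefl].
rewrite -mulN1r -scaleN1r -uea_piS -(uea_piM (UGen x)) -(uea_piM (UGen y))
  -uea_piM -uea_piD.
exact/uea_piP/UeaLie.
Qed.

Lemma uea_ind (P : uea -> Prop) :
    (forall x, P (uea_in x)) -> (forall c, P c%:A) ->
    (forall u v, P u -> P v -> P (u + v)) ->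
    (forall u v, P u -> P v -> P (u * v)) ->
  forall u, P u.
Proof.
move=> Pin Psc PD PM; elim/quotW; elim=> [x|c|s IHs t IHt|s IHs t IHt].
- exact: Pin.
- by rewrite uea_piS.
- by rewrite uea_piD; apply: PD.
- by rewrite uea_piM; apply: PM.
Qed.

(* The algebra morphism extending phi; meaningful only if phi is a
   morphism of Lie algebras (lie_morph). *)
Definition uea_lift (B : algType k) (phi : d -> B) (u : uea) : B :=
  ueval phi (repr u).

Section UeaLift.
Variables (B : algType k) (phi : d -> B).
Hypothesis phiP : lie_morph phi.

Lemma uea_lift_pi s : uea_lift phi (\pi_uea s) = ueval phi s.
Proof. exact: ueval_eq (uea_repr s). Qed.

Lemma uea_lift_in x : uea_lift phi (uea_in x) = phi x.
Proof. exact: uea_lift_pi. Qed.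

Lemma uea_lift_alg c : uea_lift phi c%:A = c%:A.
Proof. by rewrite -uea_piS uea_lift_pi. Qed.

Lemma uea_liftD : {morph uea_lift phi : u v / u + v}.
Proof.
by elim/quotW=> s; elim/quotW=> t; rewrite -uea_piD !uea_lift_pi.
Qed.

Lemma uea_liftM : {morph uea_lift phi : u v / u * v}.
Proof.
by elim/quotW=> s; elim/quotW=> t; rewrite -uea_piM !uea_lift_pi.
Qed.

Lemma uea_lift1 : uea_lift phi 1 = 1.
Proof. by rewrite -[1]scale1r uea_lift_alg scale1r. Qed.

Lemma uea_liftZ c u : uea_lift phi (c *: u) = c *: uea_lift phi u.
Proof. by rewrite -mulr_algl uea_liftM uea_lift_alg mulr_algl. Qed.

End UeaLift.

Lemma uea_ext (B : algType k) (F G : uea -> B) :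
    {morph F : u v / u + v} -> {morph F : u v / u * v} ->
    {morph G : u v / u + v} -> {morph G : u v / u * v} ->
    (forall c, F c%:A = G c%:A) -> (forall x, F (uea_in x) = G (uea_in x)) ->
  F =1 G.
Proof.
move=> FD FM GD GM Fa Fi; elim/uea_ind => // u v IHu IHv.
  by rewrite FD GD IHu IHv.
by rewrite FM GM IHu IHv.
Qed.

End Enveloping.

Section Coproduct.
Variables (k : fieldType) (d : lieAlgType k).
Local Notation H := (uea d).
Local Notation HH := (algtens H H).

Definition coprod_in (x : d) : HH := uea_in x \ot 1 + 1 \ot uea_in x.

Definition coprod : H -> HH := uea_lift coprod_in.

Lemma coprod_in_morph : lie_morph coprod_in.
Proof.
have [inl inb] := uea_in_morph d; split=> [a x y|x y].
  by rewrite /coprod_in inl otDl otDr -otZl -otZr scalerDr addrACA.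
have E u v : coprod_in u * coprod_in v =
    (uea_in u * uea_in v) \ot 1 + 1 \ot (uea_in u * uea_in v)
    + (uea_in u \ot uea_in v + uea_in v \ot uea_in u).
  rewrite /coprod_in mulrDl !mulrDr !otM !mul1r !mulr1.
  by rewrite [X in _ + X]addrC addrACA.
rewrite !E [X in _ - (_ + X)]addrC opprD addrACA subrr addr0.
rewrite /coprod_in inb -!scaleN1r otDl otDr scalerDr addrACA.
by rewrite otZl otZr.
Qed.

Lemma coprod_in_gen x : coprod (uea_in x) = uea_in x \ot 1 + 1 \ot uea_in x.
Proof. exact: uea_lift_in coprod_in_morph x. Qed.

Lemma coprodD : {morph coprod : u v / u + v}.
Proof. exact: uea_liftD coprod_in_morph. Qed.
Lemma coprodM : {morph coprod : u v / u * v}.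
Proof. exact: uea_liftM coprod_in_morph. Qed.
Lemma coprodZ c u : coprod (c *: u) = c *: coprod u.
Proof. exact: uea_liftZ coprod_in_morph c u. Qed.
Lemma coprod1 : coprod 1 = 1.
Proof. exact: uea_lift1 coprod_in_morph. Qed.

(* Triple tensors are bracketed to the left. *)
Local Notation HHH := (algtens HH H).

Definition coprod_id : HH -> HHH := atlift (fun f g => coprod f \ot g).

(* a (x) w, rebracketed. *)
Definition ot3 (a : H) : HH -> HHH := atlift (fun b c => (a \ot b) \ot c).

Definition id_coprod : HH -> HHH := atlift (fun f g => ot3 f (coprod g)).

Definition coprod3 (h : H) : HHH := coprod_id (coprod h).

Lemma coprod_id_bal : atbalanced (fun f g : H => coprod f \ot g).
Proof.
split=> [f f' g|f g g'|f c g].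
- by rewrite coprodD otDl.
- by rewrite otDr.
- by rewrite coprodZ otA.
Qed.

Lemma coprod_idE f g : coprod_id (f \ot g) = coprod f \ot g.
Proof. exact: (atliftE _ _ coprod_id_bal). Qed.
Lemma coprod_idD : {morph coprod_id : u v / u + v}.
Proof. exact: (atliftD coprod_id_bal). Qed.
Lemma coprod_idM : {morph coprod_id : u v / u * v}.
Proof.
move=> u v; move: u; apply: at_ext => [u u'|u u'|a b].
- by rewrite mulrDl coprod_idD.
- by rewrite coprod_idD mulrDl.
move: v; apply: at_ext => [u v|u v|a' b'].
- by rewrite mulrDr coprod_idD.
- by rewrite coprod_idD mulrDr.
by rewrite otM !coprod_idE otM coprodM.
Qed.

Lemma ot3_bal (a : H) : atbalanced (fun b c : H => (a \ot b) \ot c).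
Proof.
split=> [f f' g|f g g'|f c g].
- by rewrite otDr otDl.
- by rewrite otDr.
- by rewrite -otZr otA.
Qed.

Lemma ot3E a b c : ot3 a (b \ot c) = (a \ot b) \ot c.
Proof. exact: (atliftE _ _ (ot3_bal a)). Qed.
Lemma ot3Dr a : {morph ot3 a : u v / u + v}.
Proof. exact: (atliftD (ot3_bal a)). Qed.
Lemma ot3Dl a a' u : ot3 (a + a') u = ot3 a u + ot3 a' u.
Proof.
move: u; apply: at_ext => [u v|u v|b c].
- exact: ot3Dr.
- by rewrite !ot3Dr addrACA.
- by rewrite !ot3E !otDl.
Qed.
Lemma ot3Z (c : k) a u : ot3 (c *: a) u = ot3 a (c *: u).
Proof.
move: u; apply: at_ext => [u v|u v|b e].
- exact: ot3Dr.
- by rewrite scalerDr ot3Dr.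
- by rewrite otZl !ot3E otA.
Qed.
Lemma ot3M a b u v : ot3 a u * ot3 b v = ot3 (a * b) (u * v).
Proof.
move: u; apply: at_ext => [u u'|u u'|x y].
- by rewrite ot3Dr mulrDl.
- by rewrite mulrDl ot3Dr.
move: v; apply: at_ext => [u v|u v|x' y'].
- by rewrite ot3Dr mulrDr.
- by rewrite mulrDr ot3Dr.
by rewrite otM !ot3E !otM.
Qed.

Lemma id_coprod_bal : atbalanced (fun f g : H => ot3 f (coprod g)).
Proof.
split=> [f f' g|f g g'|f c g].
- exact: ot3Dl.
- by rewrite coprodD ot3Dr.
- by rewrite coprodZ ot3Z.
Qed.

Lemma id_coprodE f g : id_coprod (f \ot g) = ot3 f (coprod g).
Proof. exact: (atliftE _ _ id_coprod_bal). Qed.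
Lemma id_coprodD : {morph id_coprod : u v / u + v}.
Proof. exact: (atliftD id_coprod_bal). Qed.
Lemma id_coprodM : {morph id_coprod : u v / u * v}.
Proof.
move=> u v; move: u; apply: at_ext => [u u'|u u'|a b].
- by rewrite mulrDl id_coprodD.
- by rewrite id_coprodD mulrDl.
move: v; apply: at_ext => [u v|u v|a' b'].
- by rewrite mulrDr id_coprodD.
- by rewrite id_coprodD mulrDr.
by rewrite otM !id_coprodE ot3M coprodM.
Qed.

Lemma coprod_coassoc h : id_coprod (coprod h) = coprod3 h.
Proof.
move: h; apply: uea_ext => [u v|u v|u v|u v|c|x] /=.
- by rewrite coprodD id_coprodD.
- by rewrite coprodM id_coprodM.
- by rewrite /coprod3 coprodD coprod_idD.
- by rewrite /coprod3 coprodM coprod_idM.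
- rewrite /coprod3 coprodZ coprod1 -ot1 otZl id_coprodE coprod_idE.
  by rewrite coprodZ coprod1 -ot1 ot3E otZl.
- rewrite /coprod3 coprod_in_gen id_coprodD coprod_idD !id_coprodE !coprod_idE.
  rewrite coprod1 coprod_in_gen -ot1 ot3Dr !ot3E !otDl.
  by rewrite addrA.
Qed.

End Coproduct.

Section Pseudoalgebra.
Variables (k : fieldType) (d : lieAlgType k) (P : lmodType (uea d)).
Local Notation H := (uea d).
Local Notation HH := (algtens H H).
Local Notation HHH := (algtens HH H).

Definition ps_lact (h : H) (x : P) : P := h *: x.
(* The right actions of H on H (x) H and H (x) H (x) H through the coproduct;
   ps2 and ps3 are the corresponding products over H with P. *)
Definition ract2 (w : HH) (h : H) : HH := w * coprod h.
Definition ract3 (w : HHH) (h : H) : HHH := w * coprod3 h.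

Definition ps2 : Type := tens ract2 ps_lact.
Definition ps3 : Type := tens ract3 ps_lact.
HB.instance Definition _ := GRing.Zmodule.on ps2.
HB.instance Definition _ := GRing.Zmodule.on ps3.

Definition ps2_pure (w : HH) (x : P) : ps2 := tpure _ _ w x.
Definition ps3_pure (w : HHH) (x : P) : ps3 := tpure _ _ w x.
Local Notation "w \oH x" := (ps2_pure w x) : ring_scope.

(* Left multiplication by b (x)_H 1. *)
Definition ps2_act (b : HH) : ps2 -> ps2 :=
  tlift (fun w x => (b * w) \oH x).

(* A map out of P (x) P, curried. k-linearity in each argument is psmulH
   for scalars of H. *)
Record pseudoproduct : Type := Pseudoproduct {
  psmul :> P -> P -> ps2;
  psmulDl : forall x x' y, psmul (x + x') y = psmul x y + psmul x' y;
  psmulDr : forall x y y', psmul x (y + y') = psmul x y + psmul x y';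
  psmulH : forall (h g : H) x y,
    psmul (h *: x) (g *: y) = ps2_act (h \ot g) (psmul x y) }.

(* (b (x)_H x) * y = sum_i (b (x) 1) (Delta (x) id)(a_i) (x)_H c_i and
   x * (b (x)_H y) = sum_i (1 (x) b) (id (x) Delta)(a_i) (x)_H c_i,
   where x * y = sum_i a_i (x)_H c_i, extended additively in b (x)_H x and
   b (x)_H y. These are well defined: see ps_starlE and ps_starrE. *)
Definition ps_starl (m : pseudoproduct) (t : ps2) (y : P) : ps3 :=
  tlift (fun b x =>
    tlift (fun a c => ps3_pure ((b \ot 1) * coprod_id a) c) (m x y)) t.

Definition ps_starr (m : pseudoproduct) (x : P) (t : ps2) : ps3 :=
  tlift (fun b y =>
    tlift (fun a c => ps3_pure (ot3 1 b * id_coprod a) c) (m x y)) t.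

Definition ps_assoc (m : pseudoproduct) : Prop :=
  forall x y z, ps_starl m (m x y) z = ps_starr m x (m y z).

Lemma ps2_balanced : balanced ract2 ps_lact ps2_pure.
Proof. exact: tpure_balanced. Qed.
Lemma ps3_balanced : balanced ract3 ps_lact ps3_pure.
Proof. exact: tpure_balanced. Qed.

Lemma ps2_act_bal b : balanced ract2 ps_lact (fun w x => (b * w) \oH x).
Proof.
split=> [w w' x|w x x'|w h x].
- by rewrite mulrDr (balDl ps2_balanced).
- exact: balDr ps2_balanced _ _ _.
- by rewrite /ract2 mulrA; apply: balA ps2_balanced _ _ _.
Qed.

Lemma ps2_actE b w x : ps2_act b (w \oH x) = (b * w) \oH x.
Proof. exact: (tliftE (ps2_act_bal b)). Qed.
Lemma ps2_actD b : {morph ps2_act b : u v / u + v}.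
Proof. exact: (tliftD (ps2_act_bal b)). Qed.

Lemma ps_starl_bal2 b : balanced ract2 ps_lact
  (fun a c => ps3_pure (b * coprod_id a) c).
Proof.
split=> [w w' x|w x x'|w h x].
- by rewrite coprod_idD mulrDr (balDl ps3_balanced).
- exact: balDr ps3_balanced _ _ _.
- rewrite /ract2 coprod_idM mulrA; exact: balA ps3_balanced _ _ _.
Qed.

Lemma ps_starr_bal2 b : balanced ract2 ps_lact
  (fun a c => ps3_pure (b * id_coprod a) c).
Proof.
split=> [w w' x|w x x'|w h x].
- by rewrite id_coprodD mulrDr (balDl ps3_balanced).
- exact: balDr ps3_balanced _ _ _.
- rewrite /ract2 id_coprodM coprod_coassoc mulrA; exact: balA ps3_balanced _ _ _.
Qed.

Definition ps_starl2 (b : HHH) : ps2 -> ps3 :=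
  tlift (fun a c => ps3_pure (b * coprod_id a) c).
Definition ps_starr2 (b : HHH) : ps2 -> ps3 :=
  tlift (fun a c => ps3_pure (b * id_coprod a) c).

Lemma ps_starl2E b a c : ps_starl2 b (a \oH c) = ps3_pure (b * coprod_id a) c.
Proof. exact: (tliftE (ps_starl_bal2 b)). Qed.
Lemma ps_starl2D b : {morph ps_starl2 b : u v / u + v}.
Proof. exact: (tliftD (ps_starl_bal2 b)). Qed.
Lemma ps_starr2E b a c : ps_starr2 b (a \oH c) = ps3_pure (b * id_coprod a) c.
Proof. exact: (tliftE (ps_starr_bal2 b)). Qed.
Lemma ps_starr2D b : {morph ps_starr2 b : u v / u + v}.
Proof. exact: (tliftD (ps_starr_bal2 b)). Qed.

Lemma ps_starl_bal (m : pseudoproduct) y : balanced ract2 ps_lact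
  (fun b x => ps_starl2 (b \ot 1) (m x y)).
Proof.
split=> [w w' x|w x x'|w h x].
- move: (m x y); apply: tens_ext => [u v|u v|a c].
  + exact: ps_starl2D.
  + by rewrite !ps_starl2D addrACA.
  + by rewrite !ps_starl2E otDl mulrDl (balDl ps3_balanced).
- by rewrite psmulDl ps_starl2D.
- rewrite /ps_lact -[in RHS](scale1r y) psmulH.
  move: (m x y); apply: tens_ext => [u v|u v|a c].
  + exact: ps_starl2D.
  + by rewrite ps2_actD ps_starl2D.
  + rewrite ps2_actE !ps_starl2E coprod_idM coprod_idE mulrA otM mulr1 //.
Qed.

Lemma ps_starr_bal (m : pseudoproduct) x : balanced ract2 ps_lact
  (fun b y => ps_starr2 (ot3 1 b) (m x y)).
Proof.
split=> [w w' y|w y y'|w h y].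
- move: (m x y); apply: tens_ext => [u v|u v|a c].
  + exact: ps_starr2D.
  + by rewrite !ps_starr2D addrACA.
  + by rewrite !ps_starr2E ot3Dr mulrDl (balDl ps3_balanced).
- by rewrite psmulDr ps_starr2D.
- rewrite /ps_lact -[in RHS](scale1r x) psmulH.
  move: (m x y); apply: tens_ext => [u v|u v|a c].
  + exact: ps_starr2D.
  + by rewrite ps2_actD ps_starr2D.
  + rewrite ps2_actE !ps_starr2E id_coprodM id_coprodE mulrA ot3M mulr1 //.
Qed.

Lemma ps_starlE (m : pseudoproduct) b x y (s : seq (HH * P)) :
    m x y = \sum_(p <- s) (p.1 \oH p.2) ->
  ps_starl m (b \oH x) y =
    \sum_(p <- s) ps3_pure ((b \ot 1) * coprod_id p.1) p.2.
Proof.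
move=> mxy; rewrite /ps_starl (tliftE (ps_starl_bal m y)) mxy.
exact: (tlift_sum s (ps_starl_bal2 (b \ot 1))).
Qed.

Lemma ps_starrE (m : pseudoproduct) b x y (s : seq (HH * P)) :
    m x y = \sum_(p <- s) (p.1 \oH p.2) ->
  ps_starr m x (b \oH y) =
    \sum_(p <- s) ps3_pure (ot3 1 b * id_coprod p.1) p.2.
Proof.
move=> mxy; rewrite /ps_starr (tliftE (ps_starr_bal m x)) mxy.
exact: (tlift_sum s (ps_starr_bal2 (ot3 1 b))).
Qed.

Lemma ps_starlD (m : pseudoproduct) y :
  {morph (fun t => ps_starl m t y) : u v / u + v}.
Proof. exact: (tliftD (ps_starl_bal m y)). Qed.
Lemma ps_starrD (m : pseudoproduct) x : {morph ps_starr m x : u v / u + v}.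
Proof. exact: (tliftD (ps_starr_bal m x)). Qed.

Definition basis2 (e1 e2 : P) : Prop :=
  forall x : P, exists! h : H * H, x = h.1 *: e1 + h.2 *: e2.

End Pseudoalgebra.

Notation "w \oH x" := (ps2_pure w x) : ring_scope.

(* Main.v *)
From HB Require Import structures.
Require Import Defs.
From mathcomp Require Import all_boot all_order all_algebra.
From mathcomp Require Import ring.
From mathcomp Require boolp.

Set Implicit Arguments.
Unset Strict Implicit.
Unset Printing Implicit Defensive.

Import GRing.Theory.
Local Open Scope ring_scope.

(** Write e1 * e2 = al (x) e1 + be (x) e2 and e2 * e1 = ga (x) e1 + de (x) e2
    with al, be, ga, de in H (x) H.  Since e1, e2 is a basis, the two sides of
    an associativity law can be compared coefficient by coefficient in
    H (x) H (x) H ([ps3_inj]).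

    The law for (e1, e2, e2) says that al is a multiplicative two-cocycle of a
    one-sided kind, (al (x) 1) (Delta (x) id) al = (id (x) Delta) al.  The heart
    of the proof is that such an al is 0 or 1 ([left_cocycle]).  Put
    a1 = (id (x) eps) al and a2 = (eps (x) id) al.  Applying the counit in the
    second and in the first slot of the cocycle equation gives

      (a1 (x) 1) al = al   and   (a2 (x) 1) al = Delta a2,

    and eps a1 = eps a2.  If a2 = 0, then 1 - a1 has counit 1, hence is nonzero,
    and it annihilates al from the left, so al = 0 because H is a domain.  If
    a2 <> 0, apply id (x) f with f 1 = 0 to the second equation: on the right,
    contracting Delta a2 with f lowers the order of a2, while on the left a
    product of a2 with a nonzero element has at least the order of a2.  Hence
    (id (x) f) al = 0 for all such f, so al = a1 (x) 1; then a2 is a nonzero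
    scalar and the second equation reads al = 1 ([cocycle_trivial]).

    The order used here is the order of h as a distribution at the identity:
    h has order less than n when contracting Delta h with any n linear forms
    that vanish at 1 gives 0.  A form f vanishing at 1 acts on products like a
    derivation up to terms of order lower by two ([contract_mul]), so
    the numbers eps (D_f^n h) behave like leading symbols: they are
    multiplicative up to a binomial coefficient ([symbolM]), and by polarization
    they detect the order ([order_lt_symbol]).  In characteristic zero it
    follows that orders add under multiplication ([order_ltM_exact]).  The
    definition of the order refers to the coproduct only, so that the structure
    of U(d) as a vector space (the Poincare-Birkhoff-Witt theorem) does not
    enter.

    With al in {0, 1} the laws for (e1, e1, e2) and (e1, e2, e2) force be = 0;
    ga and de are treated by the mirror image of this argument, which is
    available because Delta is cocommutative.  The four remaining combinations
    are the four cases of the theorem, and each is associative since by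
    trilinearity over H ([ps_assoc_basis]) only basis vectors need checking. *)

(** * Linear forms and slices of tensors *)

Section Forms.
Variables (k : fieldType) (V : lmodType k).

Lemma scalar_of (phi : V -> k) :
    (forall x y, phi (x + y) = phi x + phi y) ->
    (forall c x, phi (c *: x) = c * phi x) ->
  exists f : {scalar V}, f =1 phi.
Proof.
move=> phiD phiZ.
have phiP : scalar phi by move=> c x y; rewrite phiD phiZ.
pose M := GRing.isLinear.Build k V k *%R phi phiP.
pose f : {scalar V} := HB.pack phi M.
by exists f.
Qed.

Lemma exists_form (v : V) : v != 0 -> exists f : {scalar V}, f v = 1.
Proof.
move=> /exists_functional[phi [phiD phiZ phiv]].
by have [f fE] := scalar_of phiD phiZ; exists f; rewrite fE.
Qed.

Definition form_comb (f : {scalar V}) (c : k) (g : {scalar V}) (x : V) : k :=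
  f x + c * g x.

Lemma form_comb_scalar f c g : scalar (form_comb f c g).
Proof.
move=> a x y; rewrite /form_comb !raddfD /= !scalarZ.
by rewrite !mulrDr !mulrA (mulrC c a) addrACA.
Qed.

HB.instance Definition _ f c g :=
  GRing.isLinear.Build k V k *%R (form_comb f c g) (form_comb_scalar f c g).

(** Any finite family of vectors is fixed by some finite-rank map
    pi = \sum_i f_i(-) v_i: a vector a not yet fixed by pi is absorbed by
    adding a form that factors through id - pi and takes the value 1 on a. *)
Lemma finite_frame (l : seq V) : exists s : seq ({scalar V} * V),
  forall a, a \in l -> \sum_(p <- s) p.1 a *: p.2 = a.
Proof.
elim: l => [|a l [s sP]]; first by exists [::].
pose pi x := \sum_(p <- s) p.1 x *: p.2.
have piD x y : pi (x + y) = pi x + pi y.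
  by rewrite -big_split; apply: eq_bigr => p _; rewrite raddfD scalerDl.
have piZ c x : pi (c *: x) = c *: pi x.
  by rewrite /pi scaler_sumr; apply: eq_bigr => p _ /=; rewrite scalarZ scalerA.
have [v0|v0] := eqVneq (a - pi a) 0.
  exists s => b; rewrite inE => /predU1P[->|/sP//].
  by apply/esym/eqP; rewrite -subr_eq0 v0.
have [f fv] := exists_form v0.
have [||g gE] := @scalar_of (fun x => f (x - pi x)).
- by move=> x y; rewrite piD opprD addrACA raddfD.
- by move=> c x; rewrite piZ -scalerBr scalarZ.
exists ((g, a - pi a) :: s) => b bl; rewrite big_cons /= -/(pi b) gE.
move: bl; rewrite inE => /predU1P[->|/sP bE].
  by rewrite fv scale1r subrK.
by rewrite /pi bE subrr raddf0 scale0r add0r.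
Qed.

End Forms.

Section Slices.
Variables (k : fieldType) (A B : algType k).
Local Notation AB := (algtens A B).

Definition slicel (f : {scalar A}) : AB -> B := atlift (fun a b => f a *: b).
Definition slicer (f : {scalar B}) : AB -> A := atlift (fun a b => f b *: a).

Lemma slicel_bal (f : {scalar A}) :
  atbalanced (fun (a : A) (b : B) => f a *: b).
Proof.
split=> [a a' b|a b b'|a c b].
- by rewrite raddfD scalerDl.
- by rewrite scalerDr.
- by rewrite scalarZ scalerA mulrC.
Qed.

Lemma slicer_bal (f : {scalar B}) :
  atbalanced (fun (a : A) (b : B) => f b *: a).
Proof.
split=> [a a' b|a b b'|a c b].
- by rewrite scalerDr.
- by rewrite raddfD scalerDl.
- by rewrite scalarZ scalerA mulrC.
Qed.

Lemma slicelE f a b : slicel f (a \ot b) = f a *: b.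
Proof. exact: (atliftE _ _ (slicel_bal f)). Qed.
Lemma slicelD f : {morph slicel f : u v / u + v}.
Proof. exact: (atliftD (slicel_bal f)). Qed.
Lemma slicerE f a b : slicer f (a \ot b) = f b *: a.
Proof. exact: (atliftE _ _ (slicer_bal f)). Qed.
Lemma slicerD f : {morph slicer f : u v / u + v}.
Proof. exact: (atliftD (slicer_bal f)). Qed.

Lemma slicer0 f : slicer f 0 = 0.
Proof. by apply: (addIr (slicer f 0)); rewrite -slicerD !add0r. Qed.
Lemma slicer_sum f (I : Type) (r : seq I) (F : I -> AB) :
  slicer f (\sum_(i <- r) F i) = \sum_(i <- r) slicer f (F i).
Proof. by apply: (big_morph _ (slicerD f) (slicer0 f)). Qed.
Lemma slicerZ f c u : slicer f (c *: u) = c *: slicer f u.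
Proof.
move: u; apply: at_ext => [u v|u v|a b].
- by rewrite scalerDr slicerD.
- by rewrite slicerD scalerDr.
- by rewrite otZl !slicerE !scalerA mulrC.
Qed.
Lemma slicerB f u v : slicer f (u - v) = slicer f u - slicer f v.
Proof. by rewrite slicerD -scaleN1r slicerZ scaleN1r. Qed.

Lemma slicelZ f c u : slicel f (c *: u) = c *: slicel f u.
Proof.
move: u; apply: at_ext => [u v|u v|a b].
- by rewrite scalerDr slicelD.
- by rewrite slicelD scalerDr.
- by rewrite otZl !slicelE scalarZ scalerA.
Qed.

Lemma slicer_comb f c g u :
  slicer (form_comb f c g) u = slicer f u + c *: slicer g u.
Proof.
move: u; apply: at_ext => [u v|u v|a b].
- exact: slicerD.
- by rewrite !slicerD scalerDr addrACA.
- by rewrite !slicerE scalerA -scalerDl.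
Qed.

Lemma slicer_mull f a u : slicer f ((a \ot 1) * u) = a * slicer f u.
Proof.
move: u; apply: at_ext => [u v|u v|x y].
- by rewrite mulrDr slicerD.
- by rewrite slicerD mulrDr.
- by rewrite otM !slicerE mul1r scalerAr.
Qed.

Lemma slicelM (f : {scalar A}) : {morph f : x y / x * y} ->
  {morph slicel f : u v / u * v}.
Proof.
move=> fM u v; move: u; apply: at_ext => [u u'|u u'|a b].
- by rewrite mulrDl slicelD.
- by rewrite slicelD mulrDl.
move: v; apply: at_ext => [u v|u v|a' b'].
- by rewrite mulrDr slicelD.
- by rewrite slicelD mulrDr.
by rewrite otM !slicelE fM -scalerAl -scalerAr scalerA.
Qed.

Lemma slicerM (f : {scalar B}) : {morph f : x y / x * y} ->
  {morph slicer f : u v / u * v}.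
Proof.
move=> fM u v; move: u; apply: at_ext => [u u'|u u'|a b].
- by rewrite mulrDl slicerD.
- by rewrite slicerD mulrDl.
move: v; apply: at_ext => [u v|u v|a' b'].
- by rewrite mulrDr slicerD.
- by rewrite slicerD mulrDr.
by rewrite otM !slicerE fM -scalerAl -scalerAr scalerA.
Qed.

Lemma algtens_sum (t : AB) :
  exists s : seq (A * B), t = \sum_(p <- s) p.1 \ot p.2.
Proof. by elim/quotW: t => s; exists s; apply: tens_pi_sum. Qed.

Lemma ot0l (b : B) : (0 : A) \ot b = 0.
Proof. by apply: (addIr (0 \ot b)); rewrite -otDl !add0r. Qed.
Lemma ot0r (a : A) : a \ot (0 : B) = 0.
Proof. by apply: (addIr (a \ot 0)); rewrite -otDr !add0r. Qed.

Lemma ot_suml (I : Type) (r : seq I) (F : I -> A) (b : B) :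
  (\sum_(i <- r) F i) \ot b = \sum_(i <- r) F i \ot b.
Proof.
apply: (big_morph (fun a => a \ot b)) => [a a'|]; first exact: otDl.
exact: ot0l.
Qed.
Lemma ot_sumr (I : Type) (r : seq I) (a : A) (F : I -> B) :
  a \ot (\sum_(i <- r) F i) = \sum_(i <- r) a \ot F i.
Proof.
apply: (big_morph (fun b => a \ot b)) => [b b'|]; first exact: otDr.
exact: ot0r.
Qed.

(** A tensor is recovered from its own slices.  This replaces the choice of a
    basis of B, and it is what makes the slices (id (x) f) t control t. *)
Lemma slicer_frame (t : AB) : exists s : seq ({scalar B} * B),
  t = \sum_(p <- s) slicer p.1 t \ot p.2.
Proof.
have [s ->] := algtens_sum t.
have [r rP] := finite_frame [seq p.2 | p <- s]; exists r.
under [RHS]eq_bigr do rewrite slicer_sum ot_suml.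
rewrite exchange_big /=; rewrite big_seq [RHS]big_seq.
apply: eq_bigr => p ps.
rewrite -[in LHS](rP p.2) ?map_f // ot_sumr.
by apply: eq_bigr => q _; rewrite slicerE -otZr otZl.
Qed.

Lemma slicer_eq0 (t : AB) : (forall f, slicer f t = 0) -> t = 0.
Proof.
move=> t0; have [s ->] := slicer_frame t; apply: big1 => p _.
by rewrite t0 ot0l.
Qed.

Lemma ot_eq0 (a : A) (b : B) : a \ot b = 0 -> a = 0 \/ b = 0.
Proof.
move=> ab0; have [->|/exists_form[f fb]] := eqVneq b 0; first by right.
by left; rewrite -(slicer0 f) -ab0 slicerE fb scale1r.
Qed.

Lemma ot1_eq0l (b : B) : (1 : A) \ot b = 0 -> b = 0.
Proof. by case/ot_eq0 => // /eqP; rewrite (negPf (oner_neq0 A)). Qed.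
Lemma ot1_eq0r (a : A) : a \ot (1 : B) = 0 -> a = 0.
Proof. by case/ot_eq0 => // /eqP; rewrite (negPf (oner_neq0 B)). Qed.

End Slices.

(** * The counit and the contractions of the coproduct *)

Section Counit.
Variables (k : fieldType) (d : lieAlgType k).
Local Notation H := (uea d).
Local Notation HH := (algtens H H).

Definition counit (h : H) : k := uea_lift (fun _ => 0 : k^o) h.

Lemma counit_in_morph : lie_morph (fun _ : d => 0 : k^o).
Proof.
split=> [a x y|x y]; first by rewrite scaler0 addr0.
by rewrite mulr0 subr0.
Qed.

Lemma counit_scalar : scalar counit.
Proof.
by move=> c x y; rewrite /counit (uea_liftD counit_in_morph)
  (uea_liftZ counit_in_morph).
Qed.

HB.instance Definition _ :=
  GRing.isLinear.Build k H k *%R counit counit_scalar.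

Lemma counitM : {morph counit : u v / u * v}.
Proof. exact: uea_liftM counit_in_morph. Qed.
Lemma counit1 : counit 1 = 1.
Proof. exact: uea_lift1 counit_in_morph. Qed.
Lemma counit_in x : counit (uea_in x) = 0.
Proof. exact: uea_lift_in counit_in_morph x. Qed.

Lemma slicel_counit h : slicel counit (coprod h) = h.
Proof.
have counitM' := slicelM counitM.
elim/uea_ind: h => [x|c|u v IHu IHv|u v IHu IHv].
- rewrite coprod_in_gen slicelD !slicelE /= counit_in.
  by rewrite [counit 1]counit1 scale0r add0r scale1r.
- rewrite coprodZ coprod1 -ot1 otZl slicelE scalarZ /=.
  by rewrite [counit 1]counit1 mulr1.
- by rewrite coprodD slicelD IHu IHv.
- by rewrite coprodM counitM' IHu IHv.
Qed.

Definition swap : HH -> HH := atlift (fun a b => b \ot a).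

Lemma swap_bal : atbalanced (fun a b : H => b \ot a).
Proof. by split=> [a a' b|a b b'|a c b]; rewrite ?otDl ?otDr ?otA. Qed.

Lemma swapE a b : swap (a \ot b) = b \ot a.
Proof. exact: (atliftE _ _ swap_bal). Qed.
Lemma swapD : {morph swap : u v / u + v}.
Proof. exact: (atliftD swap_bal). Qed.
Lemma swap0 : swap 0 = 0.
Proof. by apply: (addIr (swap 0)); rewrite -swapD !add0r. Qed.
Lemma swapM : {morph swap : u v / u * v}.
Proof.
move=> u v; move: u; apply: at_ext => [u u'|u u'|a b].
- by rewrite mulrDl swapD.
- by rewrite swapD mulrDl.
move: v; apply: at_ext => [u v|u v|a' b'].
- by rewrite mulrDr swapD.
- by rewrite swapD mulrDr.
by rewrite otM !swapE otM.
Qed.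
Lemma swapK : involutive swap.
Proof.
by move=> u; move: u; apply: at_ext => [u v|u v|a b]; rewrite ?swapD ?swapE.
Qed.

Lemma swap_coprod h : swap (coprod h) = coprod h.
Proof.
elim/uea_ind: h => [x|c|u v IHu IHv|u v IHu IHv].
- by rewrite coprod_in_gen swapD !swapE addrC.
- by rewrite coprodZ coprod1 -ot1 otZl swapE -otA.
- by rewrite coprodD swapD IHu IHv.
- by rewrite coprodM swapM IHu IHv.
Qed.

Lemma slicel_swap f u : slicel f (swap u) = slicer f u.
Proof.
move: u; apply: at_ext => [u v|u v|a b].
- by rewrite swapD slicelD.
- exact: slicerD.
- by rewrite swapE slicelE slicerE.
Qed.

(** The operator D_f = (id (x) f) Delta.  If H is thought of as the
    distributions supported at the identity of a group and f as a function,
    D_f h is the distribution f h; multiplication by a function vanishing at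
    the identity lowers the order of a distribution. *)
Definition contract (f : {scalar H}) (h : H) : H := slicer f (coprod h).

Lemma contract_scalar f : linear (contract f).
Proof.
by move=> c x y; rewrite /contract coprodD coprodZ slicerD slicerZ.
Qed.

HB.instance Definition _ f :=
  GRing.isLinear.Build k H H *:%R (contract f) (contract_scalar f).

Lemma contract_comb f c g h :
  contract (form_comb f c g) h = contract f h + c *: contract g h.
Proof. exact: slicer_comb. Qed.

(** By cocommutativity it does not matter on which side one contracts. *)
Lemma contractl f h : slicel f (coprod h) = contract f h.
Proof. by rewrite /contract -slicel_swap swap_coprod. Qed.

Lemma contract_counit h : contract counit h = h.
Proof. by rewrite -contractl slicel_counit. Qed.

Lemma counit_contract f h : counit (contract f h) = f h.
Proof.
rewrite -[in RHS](slicel_counit h) /contract.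
move: (coprod h); apply: at_ext => [u v|u v|a b].
- by rewrite slicerD raddfD.
- by rewrite slicelD raddfD.
- by rewrite slicerE slicelE !scalarZ mulrC.
Qed.

Lemma contract1 f : contract f 1 = (f 1)%:A.
Proof. by rewrite /contract coprod1 -ot1 slicerE. Qed.

(** Contractions on opposite sides commute by coassociativity, and by
    cocommutativity both of them may be moved to the same side. *)
Lemma contractC f g h : contract f (contract g h) = contract g (contract f h).
Proof.
have E1 t : coprod (slicer g t) = slicer g (coprod_id t).
  move: t; apply: at_ext => [u v|u v|a b].
  - by rewrite slicerD coprodD.
  - by rewrite coprod_idD !slicerD.
  - by rewrite coprod_idE !slicerE coprodZ.
have E2 a u : slicel f (slicer g (ot3 a u)) = f a *: slicer g u.
  move: u; apply: at_ext => [u v|u v|b c].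
  - by rewrite ot3Dr slicerD slicelD.
  - by rewrite slicerD scalerDr.
  - by rewrite ot3E !slicerE otZl slicelE scalarZ scalerA mulrC.
have E3 t : slicel f (slicer g (id_coprod t)) = contract g (slicel f t).
  move: t; apply: at_ext => [u v|u v|a b].
  - by rewrite id_coprodD slicerD slicelD.
  - by rewrite slicelD raddfD.
  - by rewrite id_coprodE E2 slicelE linearZ.
by rewrite -[LHS]contractl E1 -[coprod_id _]coprod_coassoc E3 contractl.
Qed.

(** * The order of an element of the enveloping algebra *)

(** [order_lt n h]: the order of h as a distribution supported at the identity
    is less than n, i.e. h is annihilated by the n-th power of the maximal ideal
    of forms vanishing at 1 in the convolution algebra dual to H.  The shift by
    one (orders less than n instead of at most n) makes 0 the only element
    of level 0. *)
Fixpoint order_lt (n : nat) (h : H) : Prop :=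
  if n is n'.+1 then
    forall f : {scalar H}, f 1 = 0 -> order_lt n' (contract f h)
  else h = 0.

Lemma order_lt0 n : order_lt n 0.
Proof. by elim: n => //= n IHn f _; rewrite raddf0. Qed.

Lemma order_ltD n g h : order_lt n g -> order_lt n h -> order_lt n (g + h).
Proof.
elim: n g h => [|n IHn] g h /=; first by move=> -> ->; rewrite addr0.
by move=> Fg Fh f f1; rewrite raddfD; apply: IHn; [apply: Fg|apply: Fh].
Qed.

Lemma order_ltZ n c h : order_lt n h -> order_lt n (c *: h).
Proof.
elim: n h => [|n IHn] h /=; first by move=> ->; rewrite scaler0.
by move=> Fh f f1; rewrite linearZ; apply: IHn; apply: Fh.
Qed.

Lemma order_lt_sum n (I : Type) (r : seq I) (F : I -> H) :
  (forall i, order_lt n (F i)) -> order_lt n (\sum_(i <- r) F i).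
Proof.
by move=> FP; apply: big_ind => //; [exact: order_lt0|exact: order_ltD].
Qed.

Lemma order_ltS n h : order_lt n h -> order_lt n.+1 h.
Proof.
elim: n h => [|n IHn] h; first by move=> -> f _; rewrite raddf0.
by move=> Fh f f1; apply: IHn; apply: Fh.
Qed.

Lemma order_lt_le m n h : (m <= n)%N -> order_lt m h -> order_lt n h.
Proof.
by move=> /subnK <-; elim: (n - m)%N => // i IHi /IHi; apply: order_ltS.
Qed.

Lemma order_lt_scal c : order_lt 1%N c%:A.
Proof. by move=> f f1; rewrite linearZ /= contract1 f1 scale0r scaler0. Qed.

(** Corrects a form by a multiple of the counit so that it vanishes at 1. *)
Definition form_aug (f : {scalar H}) : {scalar H} := form_comb f (- f 1) counit.

Lemma form_aug1 f : form_aug f 1 = 0.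
Proof.
rewrite /form_aug /= /form_comb /=.
by rewrite counit1 mulr1 subrr.
Qed.

Lemma form_augE f h : counit h = 0 -> form_aug f h = f h.
Proof. by rewrite /form_aug /= /form_comb /= => ->; rewrite mulr0 addr0. Qed.

(** Delta h - h (x) 1 is expressed through contractions of h itself by forms
    vanishing at 1, that is, through elements of smaller order than h. *)
Lemma coprod_frame h : exists s : seq ({scalar H} * H),
  coprod h = h \ot 1 + \sum_(p <- s) contract (form_aug p.1) h \ot p.2.
Proof.
have [s sE] := slicer_frame (coprod h - h \ot 1).
exists s; rewrite -[LHS](subrK (h \ot 1)) [LHS]addrC; congr (_ + _).
rewrite [LHS]sE; apply: eq_bigr => p _; congr (_ \ot _).
by rewrite slicerB slicerE contract_comb contract_counit scaleNr.
Qed.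

Lemma contract_frame (f : {scalar H}) h s : f 1 = 0 ->
    coprod h = h \ot 1 + \sum_(p <- s) contract (form_aug p.1) h \ot p.2 ->
  contract f h = \sum_(p <- s) f p.2 *: contract (form_aug p.1) h.
Proof.
move=> f1 hE; rewrite /contract {1}hE slicerD slicerE f1 scale0r add0r.
by rewrite slicer_sum; apply: eq_bigr => p _; rewrite slicerE.
Qed.

(** D_f is a derivation up to an error that is a combination of products in
    which each factor has already been contracted once.  The three sums come
    from Delta (h g) = Delta h * Delta g after separating the leading terms
    h (x) 1 and g (x) 1; the fourth product of terms dies because f 1 = 0. *)
Lemma contract_mul (f : {scalar H}) h g : f 1 = 0 ->
  exists s t : seq ({scalar H} * H),
  contract f (h * g) = contract f h * g + h * contract f g +
   \sum_(p <- s) \sum_(q <- t) f (p.2 * q.2) *: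
      (contract (form_aug p.1) h * contract (form_aug q.1) g).
Proof.
move=> f1; have [s sE] := coprod_frame h; have [t tE] := coprod_frame g.
exists s, t; rewrite (contract_frame f1 sE) (contract_frame f1 tE).
rewrite {1}/contract coprodM sE tE mulrDl !mulrDr otM mulr1 !slicerD slicerE f1.
rewrite scale0r add0r addrCA addrA; congr (_ + _ + _).
- rewrite mulr_suml [RHS]mulr_suml slicer_sum; apply: eq_bigr => p _.
  by rewrite otM slicerE mulr1 scalerAl.
- rewrite mulr_sumr [RHS]mulr_sumr slicer_sum; apply: eq_bigr => p _.
  by rewrite otM slicerE mul1r scalerAr.
rewrite mulr_suml slicer_sum; apply: eq_bigr => p _.
rewrite mulr_sumr slicer_sum; apply: eq_bigr => q _.
by rewrite otM slicerE.
Qed.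

(** With orders at most m - 1 and n - 1 the product has order at most
    m + n - 2, whence the predecessor.  The induction is on m + n, as each term
    of the Leibniz expansion has at least one contracted factor. *)
Lemma order_ltM m n h g :
  order_lt m h -> order_lt n g -> order_lt (m + n).-1 (h * g).
Proof.
have [N] := ubnP (m + n); elim: N m n h g => // N IHN [|m] [|n] h g.
- by move=> _ -> _; rewrite mul0r; apply: order_lt0.
- by move=> _ -> _; rewrite mul0r; apply: order_lt0.
- by move=> _ _ ->; rewrite mulr0; apply: order_lt0.
rewrite ltnS addSn addnS => ltN Fh Fg f f1.
have [s [t ->]] := contract_mul h g f1.
have F1 : order_lt (m + n) (contract f h * g).
  by have := IHN m n.+1 (contract f h) g; rewrite addnS; apply=> //; apply: Fh.
have F2 : order_lt (m + n) (h * contract f g).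
  by have := IHN m.+1 n h (contract f g); rewrite addSn; apply=> //; apply: Fg.
apply: order_ltD; first exact: order_ltD F1 F2.
apply: order_lt_sum => p; apply: order_lt_sum => q; apply: order_ltZ.
apply: (@order_lt_le (m + n).-1); first exact: leq_pred.
by apply: IHN; [apply: ltnW|apply: Fh|apply: Fg]; rewrite ?form_aug1.
Qed.

(** An element of d has order at most 1 because it is primitive, and d
    generates H. *)
Lemma order_lt_exists h : exists n, order_lt n h.
Proof.
elim/uea_ind: h => [x|c|u v [m Fu] [n Fv]|u v [m Fu] [n Fv]].
- exists 2%N => f f1; rewrite /contract coprod_in_gen slicerD !slicerE f1.
  rewrite scale0r add0r; exact: order_lt_scal.
- by exists 1%N; apply: order_lt_scal.
- exists (maxn m n); apply: order_ltD.
  + by apply: order_lt_le Fu; apply: leq_maxl.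
  + by apply: order_lt_le Fv; apply: leq_maxr.
- by exists (m + n).-1; apply: order_ltM.
Qed.

Lemma exact_order h : h != 0 -> exists2 n, order_lt n.+1 h & ~ order_lt n h.
Proof.
move=> h0; have [n] := order_lt_exists h; elim: n => [/eqP|n IHn Fh].
  by rewrite (negPf h0).
have [/IHn//|nF] := boolp.pselect (order_lt n h).
by exists n.
Qed.

End Counit.

Arguments counit {k d}.
Arguments swap {k d}.

(** * Symbols, and the additivity of the order *)

Section Symbol.
Variables (k : fieldType) (chark0 : [pchar k] =i pred0) (d : lieAlgType k).
Local Notation H := (uea d).

(** The pairing of h with the n-th convolution power of f.  For h of order n,
    f |-> symbol f n h is the leading symbol of h, a homogeneous polynomial of
    degree n on the space of forms vanishing at 1. *)
Definition symbol (f : {scalar H}) (n : nat) (h : H) : k :=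
  counit (iter n (contract f) h).

Lemma symbolS f n h : symbol f n.+1 h = symbol f n (contract f h).
Proof. by rewrite /symbol iterSr. Qed.

Lemma symbol_scalar f n : scalar (symbol f n).
Proof.
move=> c g h; rewrite /symbol.
have -> : iter n (contract f) (c *: g + h) =
    c *: iter n (contract f) g + iter n (contract f) h.
  by elim: n => //= n ->; rewrite linearP.
by rewrite raddfD /= scalarZ.
Qed.

HB.instance Definition _ f n :=
  GRing.isLinear.Build k H k *%R (symbol f n) (symbol_scalar f n).

Lemma symbol_order_lt (f : {scalar H}) n h :
  f 1 = 0 -> order_lt n h -> symbol f n h = 0.
Proof.
move=> f1; elim: n h => [h ->|n IHn h Fh]; first exact: raddf0.
by rewrite symbolS; apply/IHn/Fh.
Qed.

(** Contract once and use Leibniz: the error term has too small an order to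
    contribute, and the two main terms add up by the Pascal rule. *)
Lemma symbolM (f : {scalar H}) m n h g : f 1 = 0 ->
    order_lt m.+1 h -> order_lt n.+1 g ->
  symbol f (m + n) (h * g) = 'C(m + n, m)%:R * symbol f m h * symbol f n g.
Proof.
move=> f1; have [N] := ubnP (m + n).
elim: N m n h g => // N IHN m n h g /ltnSE leN Fh Fg.
have [mn0|mn0] := posnP (m + n).
  move: mn0 => /eqP; rewrite addn_eq0 => /andP[/eqP-> /eqP->].
  by rewrite bin0 mul1r [LHS]counitM.
have [s [t hgE]] := contract_mul h g f1.
rewrite -(prednK mn0) symbolS hgE.
rewrite 2!raddfD /=.
rewrite [X in _ + X]symbol_order_lt ?addr0 //; last first.
  apply: order_lt_sum => p; apply: order_lt_sum => q; apply: order_ltZ.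
  by apply: order_ltM; [apply: Fh|apply: Fg]; apply: form_aug1.
case: m n mn0 leN Fh Fg => [|m] [|n] // _ leN Fh Fg.
- have -> : contract f h = 0 by apply: Fh.
  rewrite mul0r raddf0 add0r /= (IHN 0%N n) //; last exact: Fg.
  by rewrite !bin0 symbolS.
- have -> : contract f g = 0 by apply: Fg.
  rewrite mulr0 raddf0 addr0 addn0 /= -[X in symbol _ X](addn0 m).
  rewrite (IHN m 0%N) //.
  + by rewrite addn0 !binn symbolS.
  + exact: Fh.
have -> : (m.+1 + n.+1).-1 = (m + n.+1)%N by [].
rewrite (IHN m n.+1) //; last exact: Fh.
rewrite addnS -addSn (IHN m.+1 n) //; last exact: Fg.
- by rewrite binS natrD !symbolS; ring.
- by rewrite addnS in leN.
Qed.

Lemma contract_ext (f g : {scalar H}) : f =1 g -> contract f =1 contract g.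
Proof. by move=> fg h; apply: atlift_ext => a b; rewrite fg. Qed.

Lemma symbol_ext (f g : {scalar H}) n : f =1 g -> symbol f n =1 symbol g n.
Proof. by move=> fg h; congr counit; apply/eq_iter/contract_ext. Qed.

(** The restriction of the symbol to a line f + t g is a polynomial in t whose
    linear coefficient is a polarization: n equal contributions, as the
    contractions commute. *)
Lemma symbol_line (f g : {scalar H}) n h : exists p : {poly k},
  [/\ forall t, p.[t] = symbol (form_comb f t g) n h, p`_0 = symbol f n h &
      p`_1 = n%:R * symbol f n.-1 (contract g h)].
Proof.
elim: n h => [|n IHn] h.
  by exists (counit h)%:P; split=> [t||]; rewrite ?hornerC ?coefC ?mul0r.
have [p [pE p0 p1]] := IHn (contract f h).
have [q [qE q0 q1]] := IHn (contract g h).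
exists (p + q * 'X); split.
- move=> t; rewrite symbolS contract_comb raddfD /= scalarZ /= -pE -qE.
  by rewrite hornerD hornerMX mulrC.
- by rewrite coefD coefMX addr0 p0 symbolS.
rewrite coefD coefMX /= p1 q0; case: n {IHn pE qE p0 q0 q1 p1} => [|n].
  by rewrite mul0r add0r mul1r.
by rewrite contractC -symbolS /= -[in RHS]natr1 mulrDl mul1r.
Qed.

Lemma natr_eq0 n : ((n%:R : k) == 0) = (n == 0%N).
Proof. by move: n; apply/(pcharf0P k). Qed.

Lemma poly_nonroot (p : {poly k}) : p != 0 -> exists t, p.[t] != 0.
Proof.
move=> p0; apply: boolp.contrapT => pt.
have pt0 t : root p t.
  by apply/negPn/negP => pt'; apply: pt; exists t.
have inj : injective (fun i : nat => i%:R : k).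
  move=> i j /eqP; wlog ij : i j / (i <= j)%N.
    by move=> W; case: (leqP i j) => [/W//|/ltnW/W]; rewrite eq_sym => E /E.
  rewrite eq_sym -subr_eq0 -natrB // natr_eq0 subn_eq0 => ji.
  by apply/eqP; rewrite eqn_leq ij.
have := max_poly_roots p0 (rs := mkseq (fun i => i%:R) (size p)).
rewrite size_mkseq ltnn => F; suff : false by []; apply: F.
  by apply/allP => t _; apply: pt0.
exact: mkseq_uniq.
Qed.

(** An element whose leading symbol vanishes identically drops in order.  By
    polarization (the linear coefficient along f + t g, divided by n) the
    symbols of all D_g h vanish too, and one inducts on the order. *)
Lemma order_lt_symbol n h : order_lt n.+1 h ->
  (forall f : {scalar H}, f 1 = 0 -> symbol f n h = 0) -> order_lt n h.
Proof.
elim: n h => [|n IHn] h Fh Sh.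
  apply/eqP; apply: contraT => /exists_form[f fh].
  suff /eqP : f h = 0 by rewrite fh oner_eq0.
  rewrite -(@form_augE _ _ f); last exact: Sh (form_aug1 f).
  by rewrite -[LHS]counit_contract (Fh _ (form_aug1 f)) raddf0.
move=> g g1; apply: IHn => [|f f1]; first exact: Fh.
have [p [pE _ p1]] := symbol_line f g n.+1 h.
have [p0|/poly_nonroot[t]] := eqVneq p 0.
  move: p1; rewrite p0 coef0 => /esym/eqP; rewrite mulf_eq0 natr_eq0 /=.
  by move/eqP.
rewrite pE Sh ?eqxx //.
by rewrite /= /form_comb f1 g1 mulr0 addr0.
Qed.

Lemma exists_symbol n h : order_lt n.+1 h -> ~ order_lt n h ->
  exists2 f : {scalar H}, f 1 = 0 & symbol f n h != 0.
Proof.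
move=> Fh nFh; apply: boolp.contrapT => S0.
apply/nFh/order_lt_symbol => // f f1.
by apply/eqP; apply: contraT => Sf; case: S0; exists f.
Qed.

(** Leading symbols multiply, so it suffices to find one form at which both are
    nonzero.  On the line through a good form for h and a good form for g both
    are nonzero polynomials in one variable, and a product of nonzero
    polynomials has a nonroot over an infinite field. *)
Lemma order_ltM_exact m n (h g : H) :
    order_lt m.+1 h -> ~ order_lt m h -> order_lt n.+1 g -> ~ order_lt n g ->
  ~ order_lt (m + n) (h * g).
Proof.
move=> Fh nFh Fg nFg Fhg.
have [f f1 Sf] := exists_symbol Fh nFh.
have [f' f'1 Sf'] := exists_symbol Fg nFg.
pose e : {scalar H} := form_comb f' (- 1) f.
have [p [pE p0 _]] := symbol_line f e m h.
have [q [qE _ _]] := symbol_line f e n g.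
have pN0 : p != 0 by apply: contraNneq Sf => pE0; rewrite -p0 pE0 coef0.
have qN0 : q != 0.
  apply: contraNneq Sf' => qE0; rewrite -(@symbol_ext (form_comb f 1 e)).
    by rewrite -qE qE0 horner0.
  by move=> x; rewrite /= /form_comb /= /form_comb; ring.
have [t] := poly_nonroot (mulf_neq0 pN0 qN0).
have e1 : form_comb f t e 1 = 0.
  by rewrite /form_comb /= /form_comb f1 f'1; ring.
rewrite hornerM pE qE => /eqP; apply; apply/eqP.
have := symbolM e1 Fh Fg; rewrite symbol_order_lt // => /esym/eqP.
rewrite -mulrA mulf_eq0 natr_eq0 => /orP[|//].
by rewrite -leqn0 leqNgt bin_gt0 leq_addr.
Qed.

(** Multiplying by a nonzero x cannot lower the order of a. *)
Lemma order_lt_mul_eq0 m (a x : H) :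
  order_lt m.+1 a -> ~ order_lt m a -> order_lt m (a * x) -> x = 0.
Proof.
move=> Fa nFa Fax; apply/eqP; apply: contraT => /exact_order[n Fx nFx].
case: (order_ltM_exact Fa nFa Fx nFx).
by apply: order_lt_le Fax; apply: leq_addr.
Qed.

Lemma uea_mul_eq0 (a x : H) : a != 0 -> a * x = 0 -> x = 0.
Proof.
move=> /exact_order[m Fa nFa] ax0; apply: order_lt_mul_eq0 Fa nFa _.
by rewrite ax0; apply: order_lt0.
Qed.

(** The two equations are the images under counits of a cocycle identity for
    al.  They come out the same for the left-handed identity and, after a flip,
    for the right-handed one, so that one argument serves both. *)
Lemma cocycle_trivial (al : algtens H H) :
    (slicer counit al \ot 1) * al = al ->
    (slicel counit al \ot 1) * al = coprod (slicel counit al) ->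
  al = 0 \/ al = 1.
Proof.
set a1 := slicer counit al; set a2 := slicel counit al => C1 C2.
have a1E : counit a1 = counit a2.
  rewrite /a1 /a2; move: (al); apply: at_ext => [u v|u v|a b].
  - by rewrite slicerD raddfD.
  - by rewrite slicelD raddfD.
  - by rewrite slicerE slicelE !scalarZ mulrC.
have [a20|a2N0] := eqVneq a2 0.
  (* 1 - a1 has counit 1, so it is not a zero divisor *)
  left; apply: slicer_eq0 => f.
  have a1N1 : 1 - a1 != 0.
    apply: contra_eqN (_ : counit (1 - a1) = 1) => [/eqP->|].
      by rewrite raddf0 eq_sym oner_eq0.
    by rewrite raddfB /= a1E a20 raddf0 subr0; apply: counit1.
  by apply: (uea_mul_eq0 a1N1); rewrite mulrBl mul1r -slicer_mull C1 subrr.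
right.
(* contracting lowers the order of a2, multiplying by it on the left cannot *)
have [m Fa nFa] := exact_order a2N0.
have low (f : {scalar H}) : f 1 = 0 -> slicer f al = 0.
  move=> f1; apply: (order_lt_mul_eq0 Fa nFa).
  by rewrite -slicer_mull C2; apply: Fa.
have alE : al = a1 \ot 1.
  apply/eqP; rewrite -subr_eq0; apply/eqP/slicer_eq0 => f.
  have := low _ (form_aug1 f); rewrite slicer_comb scaleNr slicerB slicerE.
  exact.
have a2E : a2 = (counit a2)%:A by rewrite -a1E /a2 alE slicelE.
have c0 : counit a2 != 0.
  by apply: contra_neq a2N0 => c0; rewrite a2E c0 scale0r.
move: C2; rewrite a2E coprodZ coprod1 -ot1 -otZl -scalerAl ot1 mul1r.
exact: scalerI.
Qed.

End Symbol.

(** * Two-cocycles with values in the tensor square *)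

Section TripleCounit.
Variables (k : fieldType) (d : lieAlgType k).
Local Notation H := (uea d).
Local Notation HH := (algtens H H).
Local Notation HHH := (algtens HH H).

(** The map F (x) id. *)
Definition on_first2 (F : HH -> H) : HHH -> HH := atlift (fun w c => F w \ot c).

Section OnFirst2.
Variable F : HH -> H.
Hypotheses (FD : {morph F : u v / u + v}) (FM : {morph F : u v / u * v})
  (FZ : forall c u, F (c *: u) = c *: F u).

Lemma on_first2_bal : atbalanced (fun w (c : H) => F w \ot c).
Proof.
split=> [w w' b|w b b'|w c b]; first by rewrite FD otDl.
  by rewrite otDr.
by rewrite FZ otA.
Qed.
Lemma on_first2E w c : on_first2 F (w \ot c) = F w \ot c.
Proof. exact: (atliftE _ _ on_first2_bal). Qed.
Lemma on_first2D : {morph on_first2 F : u v / u + v}.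
Proof. exact: (atliftD on_first2_bal). Qed.
Lemma on_first2M : {morph on_first2 F : u v / u * v}.
Proof.
move=> u v; move: u; apply: at_ext => [u u'|u u'|a b].
- by rewrite mulrDl on_first2D.
- by rewrite on_first2D mulrDl.
move: v; apply: at_ext => [u v|u v|a' b'].
- by rewrite mulrDr on_first2D.
- by rewrite on_first2D mulrDr.
by rewrite otM !on_first2E FM otM.
Qed.
End OnFirst2.

Definition counit_1 : HHH -> HH := on_first2 (slicel counit).
Definition counit_2 : HHH -> HH := on_first2 (slicer counit).
Definition counit_3 : HHH -> HH := slicer counit.

Let slE := on_first2E (@slicelD _ _ _ counit) (@slicelZ _ _ _ counit).
Let srE := on_first2E (@slicerD _ _ _ counit) (@slicerZ _ _ _ counit).
Let slD := on_first2D (@slicelD _ _ _ counit) (@slicelZ _ _ _ counit).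
Let srD := on_first2D (@slicerD _ _ _ counit) (@slicerZ _ _ _ counit).
Lemma counit_1M : {morph counit_1 : u v / u * v}.
Proof.
apply: on_first2M (@slicelD _ _ _ _) _ (@slicelZ _ _ _ _).
exact: slicelM (@counitM _ _).
Qed.
Lemma counit_2M : {morph counit_2 : u v / u * v}.
Proof.
apply: on_first2M (@slicerD _ _ _ _) _ (@slicerZ _ _ _ _).
exact: slicerM (@counitM _ _).
Qed.
Lemma counit_3M : {morph counit_3 : u v / u * v}.
Proof. exact: slicerM (@counitM _ _). Qed.

Lemma counit_1_ot w (c : H) : counit_1 (w \ot c) = slicel counit w \ot c.
Proof. exact: slE. Qed.
Lemma counit_2_ot w (c : H) : counit_2 (w \ot c) = slicer counit w \ot c.
Proof. exact: srE. Qed.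

Lemma counit_1_ot3 (a : H) w : counit_1 (ot3 a w) = counit a *: w.
Proof.
move: w; apply: at_ext => [u v|u v|b c].
- by rewrite ot3Dr /counit_1 slD.
- by rewrite scalerDr.
- by rewrite ot3E counit_1_ot slicelE otZl.
Qed.
Lemma counit_2_ot3 (a : H) w : counit_2 (ot3 a w) = a \ot slicel counit w.
Proof.
move: w; apply: at_ext => [u v|u v|b c].
- by rewrite ot3Dr /counit_2 srD.
- by rewrite slicelD otDr.
- by rewrite ot3E counit_2_ot slicerE slicelE otA.
Qed.
Lemma counit_3_ot3 (a : H) w : counit_3 (ot3 a w) = a \ot slicer counit w.
Proof.
rewrite /counit_3; move: w; apply: at_ext => [u v|u v|b c].
- by rewrite ot3Dr slicerD.
- by rewrite slicerD otDr.
- by rewrite ot3E !slicerE otZr.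
Qed.

Lemma counit_1_coprod_id w : counit_1 (coprod_id w) = w.
Proof.
move: w; apply: at_ext => [u v|u v|b c] //.
  by rewrite coprod_idD /counit_1 slD.
by rewrite coprod_idE counit_1_ot slicel_counit.
Qed.
Lemma counit_2_coprod_id w : counit_2 (coprod_id w) = w.
Proof.
move: w; apply: at_ext => [u v|u v|b c] //.
  by rewrite coprod_idD /counit_2 srD.
by rewrite coprod_idE counit_2_ot -/(contract _ _) contract_counit.
Qed.
Lemma counit_3_coprod_id w : counit_3 (coprod_id w) = coprod (slicer counit w).
Proof.
rewrite /counit_3; move: w; apply: at_ext => [u v|u v|b c].
- by rewrite coprod_idD slicerD.
- by rewrite slicerD coprodD.
- by rewrite coprod_idE !slicerE coprodZ.
Qed.

Lemma counit_1_id_coprod w : counit_1 (id_coprod w) = coprod (slicel counit w).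
Proof.
move: w; apply: at_ext => [u v|u v|b c].
- by rewrite id_coprodD /counit_1 slD.
- by rewrite slicelD coprodD.
- by rewrite id_coprodE counit_1_ot3 slicelE coprodZ.
Qed.
Lemma counit_2_id_coprod w : counit_2 (id_coprod w) = w.
Proof.
move: w; apply: at_ext => [u v|u v|b c] //.
  by rewrite id_coprodD /counit_2 srD.
by rewrite id_coprodE counit_2_ot3 slicel_counit.
Qed.
Lemma counit_3_id_coprod w : counit_3 (id_coprod w) = w.
Proof.
move: w; apply: at_ext => [u v|u v|b c] //.
  by rewrite id_coprodD /counit_3 slicerD.
by rewrite id_coprodE counit_3_ot3 -/(contract _ _) contract_counit.
Qed.

End TripleCounit.

Arguments counit_1 {k d}.
Arguments counit_2 {k d}.
Arguments counit_3 {k d}.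

Section Cocycles.
Variables (k : fieldType) (chark0 : [pchar k] =i pred0) (d : lieAlgType k).
Local Notation H := (uea d).
Local Notation HH := (algtens H H).

(** Counits in the second and first slot give the two equations of
    [cocycle_trivial]. *)
Lemma left_cocycle (al : HH) :
  (al \ot 1) * coprod_id al = id_coprod al -> al = 0 \/ al = 1.
Proof.
move=> E; apply: (cocycle_trivial chark0).
  have := congr1 counit_2 E.
  by rewrite counit_2M counit_2_ot counit_2_coprod_id counit_2_id_coprod.
have := congr1 counit_1 E.
by rewrite counit_1M counit_1_ot counit_1_coprod_id counit_1_id_coprod.
Qed.

Lemma slicer_swap (f : {scalar H}) (u : HH) : slicer f (swap u) = slicel f u.
Proof. by rewrite -slicel_swap swapK. Qed.

(** The mirror image of [left_cocycle]: counits in the second and third slot,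
    followed by the flip of the tensor factors. *)
Lemma right_cocycle (ga : HH) :
  ot3 1 ga * id_coprod ga = coprod_id ga -> ga = 0 \/ ga = 1.
Proof.
move=> E; have swap1 : swap (1 : HH) = 1 by exact: swapE.
suff [E0|E1] : swap ga = 0 \/ swap ga = 1.
- by left; rewrite -[ga]swapK E0 swap0.
- by right; rewrite -[ga]swapK E1.
apply: (cocycle_trivial chark0).
  have := congr1 counit_2 E.
  rewrite counit_2M counit_2_ot3 counit_2_coprod_id counit_2_id_coprod.
  by move/(congr1 swap); rewrite swapM swapE slicer_swap.
have := congr1 counit_3 E.
rewrite counit_3M counit_3_ot3 counit_3_coprod_id counit_3_id_coprod.
by move/(congr1 swap); rewrite swapM swapE slicel_swap swap_coprod.
Qed.

End Cocycles.

(** * Coordinates and associativity in rank two *)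

Section Coordinates.
Variables (k : fieldType) (d : lieAlgType k) (P : lmodType (uea d)) (e1 e2 : P).
Hypothesis e_basis : basis2 e1 e2.
Local Notation H := (uea d).
Local Notation HH := (algtens H H).
Local Notation HHH := (algtens HH H).

Lemma basis2_coords : exists c1 c2 : P -> H,
  [/\ forall x, x = c1 x *: e1 + c2 x *: e2,
      {morph c1 : x y / x + y} /\ (forall h x, c1 (h *: x) = h * c1 x),
      {morph c2 : x y / x + y} /\ (forall h x, c2 (h *: x) = h * c2 x) &
      [/\ c1 e1 = 1, c2 e1 = 0, c1 e2 = 0 & c2 e2 = 1]].
Proof.
have [c cP] := boolp.choice e_basis.
have cE x h1 h2 : x = h1 *: e1 + h2 *: e2 -> c x = (h1, h2).
  by move=> xE; apply: (cP x).2.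
have cD x y : c (x + y) = ((c x).1 + (c y).1, (c x).2 + (c y).2).
  by apply: cE; rewrite !scalerDl addrACA -(cP x).1 -(cP y).1.
have cZ h x : c (h *: x) = (h * (c x).1, h * (c x).2).
  by apply: cE; rewrite -!scalerA -scalerDr -(cP x).1.
exists (fun x => (c x).1), (fun x => (c x).2); split=> [x|||].
- exact: (cP x).1.
- by split=> [x y|h x]; rewrite ?cD ?cZ.
- by split=> [x y|h x]; rewrite ?cD ?cZ.
- by rewrite (cE e1 1 0) ?(cE e2 0 1) // ?scale1r ?scale0r ?addr0 ?add0r.
Qed.

(** Scalars of H are moved across (x)_H through the coproduct. *)
Lemma ps2_coords (t : ps2 P) : exists a b : HH, t = a \oH e1 + b \oH e2.
Proof.
have [c1 [c2 [cE _ _ _]]] := basis2_coords.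
have D := balDl (@ps2_balanced k d P).
elim/tens_ind: t => [w x||_ _ [a [b ->]] [a' [b' ->]]].
- exists (w * coprod (c1 x)), (w * coprod (c2 x)).
  rewrite -[tpure _ _ w x]/(w \oH x) {1}(cE x) (balDr (@ps2_balanced k d P)).
  by congr (_ + _); symmetry; apply: (balA (@ps2_balanced k d P)).
- by exists 0, 0; rewrite !(bal0l (@ps2_balanced k d P)) addr0.
- by exists (a + a'), (b + b'); rewrite !D addrACA.
Qed.

(** The coordinate functions of a basis are H-linear, so each induces a map
    H^(x)3 (x)_H P -> H^(x)3, reading off the coefficient of a basis vector. *)
Lemma ps3_inj (a b a' b' : HHH) :
    ps3_pure a e1 + ps3_pure b e2 = ps3_pure a' e1 + ps3_pure b' e2 ->
  a = a' /\ b = b'.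
Proof.
have [c1 [c2 [_ [c1D c1Z] [c2D c2Z] [c11 c21 c12 c22]]]] := basis2_coords.
have coprod3D : {morph @coprod3 _ d : u v / u + v}.
  by move=> u v; rewrite /coprod3 coprodD coprod_idD.
have coprod3M : {morph @coprod3 _ d : u v / u * v}.
  by move=> u v; rewrite /coprod3 coprodM coprod_idM.
have coprod30 : coprod3 0 = 0 :> HHH.
  by apply: (addIr (coprod3 0)); rewrite -coprod3D !add0r.
have coprod31 : coprod3 1 = 1 :> HHH.
  by rewrite /coprod3 coprod1 -ot1 coprod_idE coprod1.
have bal (c : P -> H) : {morph c : x y / x + y} ->
    (forall h x, c (h *: x) = h * c x) ->
    balanced (@ract3 _ d) (@ps_lact _ d P) (fun w x => w * coprod3 (c x)).
  move=> cD cZ; split=> [w w' x|w x x'|w h x]; first by rewrite mulrDl.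
    by rewrite cD coprod3D mulrDr.
  by rewrite /ract3 /ps_lact cZ coprod3M mulrA.
move=> E; split.
- have := congr1 (tlift (fun w x => w * coprod3 (c1 x))) E.
  rewrite !(tliftD (bal _ c1D c1Z)) !(tliftE (bal _ c1D c1Z)).
  by rewrite c11 c12 coprod30 coprod31 !mulr1 !mulr0 !addr0.
have := congr1 (tlift (fun w x => w * coprod3 (c2 x))) E.
rewrite !(tliftD (bal _ c2D c2Z)) !(tliftE (bal _ c2D c2Z)).
by rewrite c21 c22 coprod30 coprod31 !mulr1 !mulr0 !add0r.
Qed.

End Coordinates.

Section Products.
Variables (k : fieldType) (d : lieAlgType k) (P : lmodType (uea d)).
Variable star : pseudoproduct P.
Local Notation H := (uea d).
Local Notation HH := (algtens H H).
Local Notation HHH := (algtens HH H).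

Lemma ps3_pure0l (x : P) : ps3_pure 0 x = 0.
Proof. exact: (bal0l (@ps3_balanced k d P)). Qed.
Lemma ps3_pureDl w w' (x : P) :
  ps3_pure (w + w') x = ps3_pure w x + ps3_pure w' x.
Proof. exact: (balDl (@ps3_balanced k d P)). Qed.
Lemma ps2_pure0l (x : P) : 0 \oH x = 0.
Proof. exact: (bal0l (@ps2_balanced k d P)). Qed.

Lemma starl0 y : ps_starl star 0 y = 0.
Proof. exact: (tlift0 (ps_starl_bal star y)). Qed.
Lemma starr0 x : ps_starr star x 0 = 0.
Proof. exact: (tlift0 (ps_starr_bal star x)). Qed.

Lemma starl_pure0 b x y : star x y = 0 -> ps_starl star (b \oH x) y = 0.
Proof. by move=> E; rewrite (@ps_starlE _ _ _ _ b x y [::]) big_nil. Qed.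
Lemma starr_pure0 b x y : star x y = 0 -> ps_starr star x (b \oH y) = 0.
Proof. by move=> E; rewrite (@ps_starrE _ _ _ _ b x y [::]) big_nil. Qed.
Lemma starl_pure1 b x y a z : star x y = a \oH z ->
  ps_starl star (b \oH x) y = ps3_pure ((b \ot 1) * coprod_id a) z.
Proof.
by move=> E; rewrite (@ps_starlE _ _ _ _ b x y [:: (a, z)]) ?big_seq1.
Qed.
Lemma starr_pure1 b x y a z : star x y = a \oH z ->
  ps_starr star x (b \oH y) = ps3_pure (ot3 1 b * id_coprod a) z.
Proof.
by move=> E; rewrite (@ps_starrE _ _ _ _ b x y [:: (a, z)]) ?big_seq1.
Qed.
Lemma starl_pure2 b x y a z a' z' : star x y = a \oH z + a' \oH z' ->
  ps_starl star (b \oH x) y =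
   ps3_pure ((b \ot 1) * coprod_id a) z + ps3_pure ((b \ot 1) * coprod_id a') z'.
Proof.
by move=> E; rewrite (@ps_starlE _ _ _ _ b x y [:: (a, z); (a', z')])
   ?big_cons ?big_nil ?addr0.
Qed.
Lemma starr_pure2 b x y a z a' z' : star x y = a \oH z + a' \oH z' ->
  ps_starr star x (b \oH y) =
   ps3_pure (ot3 1 b * id_coprod a) z + ps3_pure (ot3 1 b * id_coprod a') z'.
Proof.
by move=> E; rewrite (@ps_starrE _ _ _ _ b x y [:: (a, z); (a', z')])
   ?big_cons ?big_nil ?addr0.
Qed.

Lemma coprod_id_unit : coprod_id (1 \ot 1) = 1 :> HHH.
Proof. by rewrite coprod_idE coprod1. Qed.
Lemma id_coprod_unit : id_coprod (1 \ot 1) = 1 :> HHH.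
Proof. by rewrite id_coprodE coprod1 -ot1 ot3E. Qed.
Lemma starl_unit x y a z a' z' : star x y = a \oH z + a' \oH z' ->
  ps_starl star (1 \ot 1 \oH x) y =
   ps3_pure (coprod_id a) z + ps3_pure (coprod_id a') z'.
Proof.
move=> /starl_pure2 ->.
by congr (ps3_pure _ _ + ps3_pure _ _); apply: mul1r.
Qed.
Lemma starr_unit x y a z a' z' : star x y = a \oH z + a' \oH z' ->
  ps_starr star x (1 \ot 1 \oH y) =
   ps3_pure (id_coprod a) z + ps3_pure (id_coprod a') z'.
Proof.
have ot3_unit : ot3 1 (1 \ot 1) = 1 :> HHH by rewrite ot3E.
by move=> /starr_pure2 ->; rewrite ot3_unit !mul1r.
Qed.

(** Left multiplication by b (x)_H 1: the action for which both triple products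
    are H-trilinear. *)
Definition ps3_act (b : HHH) : ps3 P -> ps3 P :=
  tlift (fun w x => ps3_pure (b * w) x).

Lemma ps3_act_bal b :
  balanced (@ract3 _ d) (@ps_lact _ d P) (fun w x => ps3_pure (b * w) x).
Proof.
split=> [w w' x|w x x'|w h x].
- by rewrite mulrDr ps3_pureDl.
- exact: balDr (@ps3_balanced k d P) _ _ _.
- by rewrite /ract3 mulrA; apply: balA (@ps3_balanced k d P) _ _ _.
Qed.
Lemma ps3_actE b w x : ps3_act b (ps3_pure w x) = ps3_pure (b * w) x.
Proof. exact: (tliftE (ps3_act_bal b)). Qed.
Lemma ps3_actD b : {morph ps3_act b : u v / u + v}.
Proof. exact: (tliftD (ps3_act_bal b)). Qed.

Lemma starlE2 b x y :
  ps_starl star (b \oH x) y = ps_starl2 (b \ot 1) (star x y).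
Proof. exact: (tliftE (ps_starl_bal star y)). Qed.
Lemma starrE2 b x y :
  ps_starr star x (b \oH y) = ps_starr2 (ot3 1 b) (star x y).
Proof. exact: (tliftE (ps_starr_bal star x)). Qed.

Lemma starl_act h g l t z :
  ps_starl star (ps2_act (h \ot g) t) (l *: z) =
  ps3_act ((h \ot g) \ot l) (ps_starl star t z).
Proof.
move: t; apply: tens_ext => [u v|u v|w x].
- by rewrite ps2_actD ps_starlD.
- by rewrite ps_starlD ps3_actD.
rewrite -/(w \oH x) ps2_actE !starlE2 -[x in star x (l *: z)]scale1r psmulH.
move: (star x z); apply: tens_ext => [u v|u v|a c].
- by rewrite ps2_actD ps_starl2D.
- by rewrite ps_starl2D ps3_actD.
rewrite -/(a \oH c) ps2_actE !ps_starl2E ps3_actE; congr ps3_pure.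
by rewrite coprod_idM coprod_idE coprod1 !mulrA !otM mul1r !mulr1.
Qed.

Lemma starr_act h g l x t :
  ps_starr star (h *: x) (ps2_act (g \ot l) t) =
  ps3_act ((h \ot g) \ot l) (ps_starr star x t).
Proof.
move: t; apply: tens_ext => [u v|u v|w y].
- by rewrite ps2_actD ps_starrD.
- by rewrite ps_starrD ps3_actD.
rewrite -/(w \oH y) ps2_actE !starrE2 -[y in star (h *: x) y]scale1r psmulH.
move: (star x y); apply: tens_ext => [u v|u v|a c].
- by rewrite ps2_actD ps_starr2D.
- by rewrite ps_starr2D ps3_actD.
rewrite -/(a \oH c) ps2_actE !ps_starr2E ps3_actE; congr ps3_pure.
by rewrite id_coprodM id_coprodE coprod1 !mulrA -ot3E !ot3M mul1r !mulr1.
Qed.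

(** Both triple products are additive in each argument and H-trilinear, so the
    law extends from a basis to its H-span. *)
Lemma ps_assoc_basis (e1 e2 : P) : basis2 e1 e2 ->
    (forall x y z,
      (x = e1 \/ x = e2) -> (y = e1 \/ y = e2) -> (z = e1 \/ z = e2) ->
      ps_starl star (star x y) z = ps_starr star x (star y z)) ->
  ps_assoc star.
Proof.
move=> e_basis E.
pose Q x y z := ps_starl star (star x y) z = ps_starr star x (star y z).
have QZ h g l x y z : Q x y z -> Q (h *: x) (g *: y) (l *: z).
  by rewrite /Q => xyz; rewrite !psmulH starl_act starr_act xyz.
have starrDl x x' t :
    ps_starr star (x + x') t = ps_starr star x t + ps_starr star x' t.
  move: t; apply: tens_ext => [u v|u v|w y].
  - by rewrite ps_starrD.
  - by rewrite !ps_starrD; apply: addrACA.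
  by rewrite -/(w \oH y) !starrE2 psmulDl ps_starr2D.
have starlDr y y' t :
    ps_starl star t (y + y') = ps_starl star t y + ps_starl star t y'.
  move: t; apply: tens_ext => [u v|u v|w x].
  - by rewrite ps_starlD.
  - by rewrite !ps_starlD; apply: addrACA.
  by rewrite -/(w \oH x) !starlE2 psmulDr ps_starl2D.
have Q1 x x' y z : Q x y z -> Q x' y z -> Q (x + x') y z.
  by rewrite /Q psmulDl ps_starlD starrDl => -> ->.
have Q2 x y y' z : Q x y z -> Q x y' z -> Q x (y + y') z.
  by rewrite /Q psmulDl psmulDr ps_starlD ps_starrD => -> ->.
have Q3 x y z z' : Q x y z -> Q x y z' -> Q x y (z + z').
  by rewrite /Q psmulDr starlDr ps_starrD => -> ->.
have [c1 [c2 [cE _ _ _]]] := basis2_coords e_basis.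
move=> x y z; rewrite -/(Q x y z) (cE x) (cE y) (cE z).
by apply: Q1; apply: Q2; apply: Q3; apply: QZ; apply: E; auto.
Qed.

End Products.

(** * The classification *)

Section Main.
Variables (k : fieldType) (chark0 : [pchar k] =i pred0) (d : lieAlgType k).
Variables (P : lmodType (uea d)) (e1 e2 : P).
Hypothesis e_basis : basis2 e1 e2.
Variable star : pseudoproduct P.
Hypotheses (star11 : star e1 e1 = 0) (star22 : star e2 e2 = 1 \ot 1 \oH e2).
Hypothesis assoc : ps_assoc star.
Local Notation H := (uea d).
Local Notation HH := (algtens H H).

(** al is a cocycle by the e1-coefficient of the law for (e1, e2, e2).  For
    al = 1 the e1-coefficient of the law for (e1, e1, e2) is 1 (x) be = 0.
    For al = 0 the e2-coefficient of the law for (e1, e2, e2) makes be of the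
    form b (x) 1, and then that for (e1, e1, e2) is b (x) b (x) 1 = 0. *)
Lemma star12_cases : star e1 e2 = 0 \/ star e1 e2 = 1 \ot 1 \oH e1.
Proof.
have [al [be E12]] := ps2_coords e_basis (star e1 e2).
have [A B] : (al \ot 1) * coprod_id al = id_coprod al /\
    (al \ot 1) * coprod_id be + be \ot 1 = id_coprod be.
  apply: (ps3_inj e_basis); have := assoc e1 e2 e2.
  rewrite star22 (starr_unit E12) {1}E12 ps_starlD (starl_pure2 _ E12).
  rewrite (starl_pure1 _ star22) coprod_id_unit mulr1 => <-.
  by rewrite ps3_pureDl addrA.
have [A' B'] : ot3 1 be * id_coprod al = 0 /\ ot3 1 be * id_coprod be = 0.
  apply: (ps3_inj e_basis); have := assoc e1 e1 e2.
  rewrite star11 starl0 {1}E12 ps_starrD.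
  rewrite (starr_pure0 _ star11) (starr_pure2 _ E12).
  by rewrite !ps3_pure0l add0r addr0 => <-.
suff be0 : be = 0.
  have [al0|al1] := left_cocycle chark0 A; [left|right];
    by rewrite E12 be0 ?al0 ?al1 !ps2_pure0l ?addr0.
have [al0|al1] := left_cocycle chark0 A.
  have [b beE] : exists b, be = b \ot 1.
    by exists (slicer counit be); have := congr1 counit_2 B;
      rewrite al0 ot0l mul0r add0r counit_2_ot counit_2_id_coprod.
  rewrite beE; move: B'; rewrite -B al0 ot0l mul0r add0r beE.
  rewrite ot3E !otM !mul1r mulr1.
  by move=> /ot1_eq0r /ot_eq0[]->; rewrite ot0l.
have := congr1 counit_1 A'.
rewrite al1 -ot1 id_coprodE coprod1 -ot1 ot3E mulr1 counit_1_ot3.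
rewrite [counit 1]counit1 scale1r => ->.
by rewrite -(ot0r _ (0 : HH)) counit_1_ot ot0r.
Qed.

(** The mirror image of [star12_cases], from the laws for (e2, e2, e1) and
    (e2, e1, e1). *)
Lemma star21_cases : star e2 e1 = 0 \/ star e2 e1 = 1 \ot 1 \oH e1.
Proof.
have [ga [de E21]] := ps2_coords e_basis (star e2 e1).
have [G D] : ot3 1 ga * id_coprod ga = coprod_id ga /\
    ot3 1 ga * id_coprod de + ot3 1 de = coprod_id de.
  apply: (ps3_inj e_basis); have := assoc e2 e2 e1.
  rewrite star22 (starl_unit E21) {1}E21 ps_starrD (starr_pure2 _ E21).
  rewrite (starr_pure1 _ star22) id_coprod_unit mulr1 => ->.
  by rewrite ps3_pureDl addrA.
have [G' D'] : (de \ot 1) * coprod_id ga = 0 /\ (de \ot 1) * coprod_id de = 0.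
  apply: (ps3_inj e_basis); have := assoc e2 e1 e1.
  rewrite star11 starr0 {1}E21 ps_starlD.
  rewrite (starl_pure0 _ star11) (starl_pure2 _ E21).
  by rewrite !ps3_pure0l add0r addr0 => ->.
suff de0 : de = 0.
  have [ga0|ga1] := right_cocycle chark0 G; [left|right];
    by rewrite E21 de0 ?ga0 ?ga1 !ps2_pure0l ?addr0.
have [ga0|ga1] := right_cocycle chark0 G.
  have ot30 : ot3 1 (0 : HH) = 0 by rewrite -(ot0l _ 0) ot3E !ot0r.
  have [b deE] : exists b, de = 1 \ot b.
    by exists (slicel counit de); have := congr1 counit_2 D;
      rewrite ga0 ot30 mul0r add0r counit_2_ot3 counit_2_coprod_id.
  rewrite deE; move: D'; rewrite -D ga0 ot30 mul0r add0r deE.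
  rewrite ot3E !otM !mul1r mulr1.
  by move=> /ot_eq0[/ot1_eq0l|]->; rewrite ot0r.
move: G'; rewrite ga1 -ot1 coprod_idE coprod1 mulr1.
exact: ot1_eq0r.
Qed.

End Main.

Theorem theorem4p3 (k : closedFieldType) (chark0 : [pchar k] =i pred0)
    (d : lieAlgType k) (P : lmodType (uea d)) (e1 e2 : P)
    (e_basis : basis2 e1 e2) (star : pseudoproduct P)
    (star11 : star e1 e1 = 0)
    (star22 : star e2 e2 = 1 \ot 1 \oH e2) :
  ps_assoc star <->
  [\/ star e1 e2 = 0 /\ star e2 e1 = 0,
      star e1 e2 = 0 /\ star e2 e1 = 1 \ot 1 \oH e1,
      star e1 e2 = 1 \ot 1 \oH e1 /\ star e2 e1 = 0
    | star e1 e2 = 1 \ot 1 \oH e1 /\ star e2 e1 = 1 \ot 1 \oH e1].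
Proof.
split=> [assoc|cases].
  have [E12|E12] := star12_cases chark0 e_basis star11 star22 assoc;
  have [E21|E21] := star21_cases chark0 e_basis star11 star22 assoc.
  - by constructor 1.
  - by constructor 2.
  - by constructor 3.
  - by constructor 4.
apply: (ps_assoc_basis e_basis) => x y z.
by case: cases => [] [E12 E21] [->|->] [->|->] [->|->];
  rewrite ?star11 ?star22 ?E12 ?E21 ?starl0 ?starr0
    ?(starl_pure0 _ star11) ?(starr_pure0 _ star11)
    ?(starl_pure1 _ star22) ?(starr_pure1 _ star22)
    ?(starl_pure0 _ E12) ?(starr_pure0 _ E12)
    ?(starl_pure0 _ E21) ?(starr_pure0 _ E21)
    ?(starl_pure1 _ E12) ?(starr_pure1 _ E12)
    ?(starl_pure1 _ E21) ?(starr_pure1 _ E21)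
    ?coprod_id_unit ?id_coprod_unit ?ot3E.
Qed.
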